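(* Let $G=(V,E)$ be a directed acyclic graph containing no active cycle, and let $X,Y,Z\subseteq V$ be pairwise disjoint ($X,Y$ nonempty, $Z$ possibly empty) such that $Y\sqcup Z$ has local relationships and $\mathrm{TRAILS}(X,Y\mid Z)\neq\emptyset$. Let $T\in\mathrm{TRAILS}(X,Y\mid Z)$ be a minimal element with respect to $<_{TRAIL}$, written as $$x\sim t^0_1\sim\cdots\sim t^0_{n_t(0)}\to c_1\leftarrow t^1_1\sim\cdots\sim t^1_{n_t(1)}\to c_2\leftarrow\cdots\to c_C\leftarrow t^C_1\sim\cdots\sim t^C_{n_t(C)}\sim y,$$ with $x\in X$, $y\in Y$, converging nodes $c_1,\dots,c_C$, and conventions $c_0:=x$, $c_{C+1}:=y$, $t^i_0:=c_i$, $t^i_{n_t(i)+1}:=c_{i+1}$. Then: (i) if $C\ge1$, then $c_C\in Z$; (ii) for all $i=1,\dots,C-1$, $c_i\in Z$ or $c_{i+1}\in Z$; (iii) for all $i=1,\dots,C$, the nodes $c_i$ and $c_{i+1}$ are adjacent; (iv) if $C>0$, then for every $i=1,\dots,C$, writing $n=n_t(i)$, the graph $G$ contains one of the following two sets of arcs: (a) $c_i\to c_{i+1}$, $t^i_1\to c_i$, $t^i_j\to t^i_{j+1}$ for $j=1,\dots,n$, and $c_i\to t^i_j$ for $j=2,\dots,n$; or (b) $c_{i+1}\to c_i$, $t^i_1\to c_i$, $t^i_{j+1}\to t^i_j$ for $j=1,\dots,n-1$, $t^i_n\to c_{i+1}$, and $c_{i+1}\to t^i_j$ for $j=1,\dot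s,n-1$.
   Context: Graphs are finite, simple, without loops. $G=(V,E)$ is a DAG; $\mathrm{de}(v)$ is the set of nodes reachable from $v$ by a directed path of positive length. A trail is a sequence of pairwise distinct nodes $v_1,\dots,v_n$ with consecutive nodes adjacent (arc in either direction), written $v_1\sim\cdots\sim v_n$ (with $\to$/$\leftarrow$ indicating a known direction). An interior node $v_j$ is a converging connection if $v_{j-1}\to v_j\leftarrow v_{j+1}$, otherwise serial or diverging. A trail is activated by $Z\subseteq V$ if every interior converging node $v_j$ satisfies $(\{v_j\}\cup\mathrm{de}(v_j))\cap Z\neq\emptyset$ and every interior non-converging node is not in $Z$; ''activated by the empty set'' means no converging connections. $G$ contains an active cycle if there exist a node $v$, distinct parents $w,z$ of $v$, and a trail $w\sim x_1\sim\cdots\sim x_n\sim z$ with $n\ge1$ all of whose interior nodes are serial or diverging connections, such that the cycle $v,w,x_1,\dots,x_n,z$ has no arc of $G$ between two of its nodes that are not consecutive in this cyclic order. A set $K\subseteq V$ has local relationships if for all $v_1,v_2\in K$ such that there is a trail $v_1\sim x_1\sim\cdots\sim x_n\sim v_2$ with no converging connection and all $x_i\notin K$, the nodes $v_1,v_2$ are adjacent. $\mathrm{TRAILS}(X,Y\mid Z)$ is the set of trails from a node of $X$ to a node of $Y$ activated by $Z$. For such a trail $T$, $c_1,\dots,c_C$ ($C\ge0$) are its converging nodes in order of appearance from $X$ to $Y$, and the nodes strictly between $c_i$ and $c_{i+1}$ are $t^i_1,\dots,t^i_{n_t(i)}$. For $c_i\notin Z$, $n_Z(i)$ is the number of interior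 nodes of a shortest directed path from $c_i$ to a node of $Z$; if $c_i\in Z$, $n_Z(i)=0$. Order: $T_1<_{TRAIL}T_2$ iff the vector $\big(|\{c_i\}\setminus Z|,\ C,\ \sum_{i=1}^{C}n_Z(i),\ \sum_{i=0}^{C}n_t(i)\big)$ of $T_1$ is lexicographically strictly smaller than that of $T_2$. A minimal element is a $T$ with no $T'\in\mathrm{TRAILS}(X,Y\mid Z)$ with $T'<_{TRAIL}T$.
   Formalization: In (iv)(b) the arc t^i_n → c_{i+1} is required only when n ≥ 1; for n = 0 the convention t^i_0 = c_i makes (iv) false, e.g. for x → c ← y with X={x}, Y={y}, Z={c}. *)

(* Defs.v *)
From HB Require Import structures.
From mathcomp Require Import all_boot all_order.

Set Implicit Arguments.
Unset Strict Implicit.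
Unset Printing Implicit Defensive.

Import Order.SeqLexiOrder.Exports.

(* A directed graph on a finite type V is its arc relation e : e u v is the
   arc u -> v.  A trail is given in the style of path.v, by its first node x
   and the sequence p of the remaining nodes. *)

Section Graph.
Variables (V : finType) (e : rel V).

(* In particular no loops ([:: v]) and no pair of opposite arcs. *)
Definition acyclic : Prop := forall s : seq V, cycle e s -> s = [::].

Definition adj : rel V := [rel u v | e u v || e v u].

Definition de (v : V) : {set V} := [set w | [exists u, e v u && connect e u w]].

Definition trail (x : V) (p : seq V) : bool := path adj x p && uniq (x :: p).

Definition node (x : V) (p : seq V) (j : nat) : V := nth x (x :: p) j.

(* Positions of the interior nodes; the end nodes are at positions 0 and
   size p. *)
Definition interior (p : seq V) : seq nat := iota 1 (size p).-1.

Definition converging (x : V) (p : seq V) (j : nat) : bool :=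
  e (node x p j.-1) (node x p j) && e (node x p j.+1) (node x p j).

Definition no_converging (x : V) (p : seq V) : bool :=
  all (fun j => ~~ converging x p j) (interior p).

Definition activated (Z : {set V}) (x : V) (p : seq V) : bool :=
  all (fun j => if converging x p j
                then (node x p j |: de (node x p j)) :&: Z != set0
                else node x p j \notin Z)
      (interior p).

Definition chordless (s : seq V) : Prop :=
  forall a b, a \in s -> b \in s -> e a b -> (b == next s a) || (a == next s b).

Definition has_active_cycle : Prop :=
  exists (v w z : V) (xs : seq V),
    let cyc := v :: w :: rcons xs z in
    [/\ w != z /\ (e w v /\ e z v),
        xs != [::],
        trail w (rcons xs z) /\ no_converging w (rcons xs z)
      & uniq cyc /\ chordless cyc].

Definition local_relationships (K : {set V}) : Prop :=
  forall (v1 v2 : V) (xs : seq V),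
    v1 \in K -> v2 \in K ->
    trail v1 (rcons xs v2) -> no_converging v1 (rcons xs v2) ->
    (forall u, u \in xs -> u \notin K) ->
    adj v1 v2.

Definition TRAILS (X Y Z : {set V}) (x : V) (p : seq V) : bool :=
  [&& trail x p, x \in X, last x p \in Y & activated Z x p].

Definition conv_pos (x : V) (p : seq V) : seq nat :=
  [seq j <- interior p | converging x p j].

Definition nconv (x : V) (p : seq V) : nat := size (conv_pos x p).

(* pos x p i is the position of c_i: c_0 = x is at position 0, the converging
   nodes c_1, ..., c_C follow, and c_(C+1) is the last node, at position size p
   (the default value of nth). *)
Definition pos (x : V) (p : seq V) (i : nat) : nat :=
  nth (size p) (0 :: conv_pos x p) i.

Definition cnode (x : V) (p : seq V) (i : nat) : V := node x p (pos x p i).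

Definition nt (x : V) (p : seq V) (i : nat) : nat :=
  (pos x p i.+1 - pos x p i).-1.

(* t^i_j for 0 <= j <= nt x p i + 1, so that t^i_0 = c_i and
   t^i_(nt x p i + 1) = c_(i+1). *)
Definition tnode (x : V) (p : seq V) (i j : nat) : V :=
  node x p (pos x p i + j).

(* The least number n of interior nodes of a directed path (with n + 1 arcs)
   from c to a node of Z.  find ranges over n < #|V|; its value is junk (#|V|)
   only if Z is not reachable from c. *)
Definition nZ (Z : {set V}) (c : V) : nat :=
  if c \in Z then 0
  else find (fun n => [exists q : n.+1.-tuple V,
                         path e c q && (last c q \in Z)])
            (iota 0 #|V|).

Definition trail_vector (Z : {set V}) (x : V) (p : seq V) : seq nat :=
  let C := nconv x p in
  [:: #|[set c in [seq node x p j | j <- conv_pos x p]] :\: Z|;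
      C;
      \sum_(1 <= i < C.+1) nZ Z (cnode x p i);
      \sum_(0 <= i < C.+1) nt x p i].

Definition trail_lt (Z : {set V}) (x' : V) (p' : seq V) (x : V) (p : seq V) :
    bool :=
  ((trail_vector Z x' p' : seqlexi nat) < (trail_vector Z x p : seqlexi nat))%O.

Definition minimal_trail (X Y Z : {set V}) (x : V) (p : seq V) : Prop :=
  TRAILS X Y Z x p /\
  forall x' p', TRAILS X Y Z x' p' -> ~~ trail_lt Z x' p' x p.

End Graph.

(* Main.v *)
(** Write c -> d_1 -> ... -> d_m for a shortest directed path from a converging
    node c to Z.  By minimality of the trail such a path meets the trail only
    in c, does not meet Y, and does not meet the path of the next converging
    node, since otherwise rerouting the trail along it lowers the cost.  So for
    consecutive converging nodes a and b (or b = y), the two paths together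
    with the piece of the trail between a and b form a trail W without
    converging nodes whose ends lie in Y or Z and whose interior avoids both;
    local relationships make the ends of W adjacent.  Minimality also shows
    that every other chord of W starts at an end of W lying in Z, hence, by
    acyclicity, at the tail w_0 of the arc joining the two ends (if this tail is
    y, then W is a single arc).  Without active cycles w_0 must then point to
    every node of W but its neighbour w_1.  This orients W away from w_1, which
    forces the directed path at that end to be empty: the corresponding
    converging node is w_0 itself, lies in Z, and has the fan described in
    (iv). *)
Require Import Defs.
From HB Require Import structures.
From mathcomp Require Import all_boot all_order.
From mathcomp Require Import zify.

Set Implicit Arguments.
Unset Strict Implicit.
Unset Printing Implicit Defensive.

(* lia on a context purged of the boolean facts about the graph, which lia
   would otherwise case-split. *)
Ltac nat_lia :=
  repeat match goal with H : is_true ?b |- _ =>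
    lazymatch b with
    | leq _ _ => fail
    | andb (leq _ _) _ => fail
    | negb (eq_op _ _) => fail
    | _ => clear H
    end
  end; lia.

(** * Contexts of nodes and the cost of a piece of a trail *)

Section Contexts.
Variables (V : finType) (e : rel V) (Z : {set V}).

Definition hdo (o : option V) (s : seq V) := if s is v :: _ then Some v else o.
Definition lasto (o : option V) (s : seq V) :=
  if s is v :: s' then Some (last v s') else o.

(* Each node of s with its two neighbours; o and o' stand for the neighbours
   of the two ends of s, so that a piece of a trail keeps its contexts. *)
Fixpoint contexts (o : option V) (s : seq V) (o' : option V) :
    seq (option V * V * option V) :=
  if s is v :: s' then (o, v, hdo o' s') :: contexts (Some v) s' o'
  else [::].

Definition conv_ctx (t : option V * V * option V) : bool :=
  if t is (Some u, v, Some w) then e u v && e w v else false.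

(** A [None] marks an end node of the whole trail, which is subject to no condition. *)
Definition active_ctx (t : option V * V * option V) : bool :=
  if t is (Some u, v, Some w) then
    if e u v && e w v then (v |: de e v) :&: Z != set0 else v \notin Z
  else true.

Definition convs o s o' : seq V :=
  [seq t.1.2 | t <- contexts o s o' & conv_ctx t].

Definition active o s o' : bool := all active_ctx (contexts o s o').

Lemma hdo_cat o s1 s2 : hdo o (s1 ++ s2) = hdo (hdo o s2) s1.
Proof. by case: s1. Qed.

Lemma lasto_cat o s1 s2 : lasto o (s1 ++ s2) = lasto (lasto o s1) s2.
Proof. by case: s1 s2 => [|v s1] [|w s2] //=; rewrite ?cats0 // last_cat. Qed.

Lemma hdo_rev o s : hdo o (rev s) = lasto o s.
Proof. by case/lastP: s => [|[|u s] v] //; rewrite rev_rcons //= last_rcons. Qed.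

Lemma lasto_rev o s : lasto o (rev s) = hdo o s.
Proof. by rewrite -hdo_rev revK. Qed.

Lemma contexts_cat o s1 s2 o' :
  contexts o (s1 ++ s2) o' =
  contexts o s1 (hdo o' s2) ++ contexts (lasto o s1) s2 o'.
Proof.
elim: s1 o => [|v s1 IH] o //=; rewrite IH hdo_cat; congr (_ :: _ ++ _).
by case: s1 {IH}.
Qed.

Lemma contexts_rev o s o' :
  contexts o (rev s) o' =
  rev [seq (t.2, t.1.2, t.1.1) | t <- contexts o' s o].
Proof.
elim: s o' => [|v s IH] o' //=.
rewrite rev_cons -cats1 contexts_cat /= IH rev_cons cats1 lasto_rev.
by [].
Qed.

Lemma convs_cat o s1 s2 o' :
  convs o (s1 ++ s2) o' = convs o s1 (hdo o' s2) ++ convs (lasto o s1) s2 o'.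
Proof. by rewrite /convs contexts_cat filter_cat map_cat. Qed.

Lemma active_cat o s1 s2 o' :
  active o (s1 ++ s2) o' =
  active o s1 (hdo o' s2) && active (lasto o s1) s2 o'.
Proof. by rewrite /active contexts_cat all_cat. Qed.

Lemma convs_cons o v s o' :
  convs o (v :: s) o' =
  (if conv_ctx (o, v, hdo o' s) then [:: v] else [::]) ++ convs (Some v) s o'.
Proof. by rewrite /convs /=; case: ifP. Qed.

Lemma active_cons o v s o' :
  active o (v :: s) o' =
  active_ctx (o, v, hdo o' s) && active (Some v) s o'.
Proof. by []. Qed.

Lemma conv_ctx_sym o v o' : conv_ctx (o, v, o') = conv_ctx (o', v, o).
Proof. by case: o o' => [u|] [w|] //=; rewrite andbC. Qed.

Lemma active_ctx_sym o v o' : active_ctx (o, v, o') = active_ctx (o', v, o).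
Proof. by case: o o' => [u|] [w|] //=; rewrite andbC. Qed.

Lemma convs_rev o s o' : convs o (rev s) o' = rev (convs o' s o).
Proof.
rewrite /convs contexts_rev filter_rev filter_map map_rev -map_comp.
congr (rev (map _ _)); apply: eq_filter => -[[o1 v] o2] /=.
exact: conv_ctx_sym.
Qed.

Lemma active_rev o s o' : active o (rev s) o' = active o' s o.
Proof.
rewrite /active contexts_rev all_rev all_map.
by apply: eq_all => -[[o1 v] o2]; apply: active_ctx_sym.
Qed.

Lemma mem_convs o s o' v : v \in convs o s o' -> v \in s.
Proof.
elim: s o => [|u s IH] o //; rewrite convs_cons mem_cat inE => /orP [|/IH ->].
  by case: ifP => // _; rewrite inE => ->.
by rewrite orbT.
Qed.

(* The cost of a trail, as far as its converging nodes are concerned, is a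
   sum over these nodes, and [better] is stable under adding the same pieces
   on both sides. *)
Definition le3 (l' l : seq V) : bool :=
  [&& count [predC Z] l' <= count [predC Z] l, size l' <= size l
    & sumn (map (nZ e Z) l') <= sumn (map (nZ e Z) l)].

Definition lt3 (l' l : seq V) : bool :=
  le3 l' l && [|| count [predC Z] l' < count [predC Z] l, size l' < size l
    | sumn (map (nZ e Z) l') < sumn (map (nZ e Z) l)].

Definition better (l' : seq V) (n' : nat) (l : seq V) (n : nat) : bool :=
  le3 l' l && (lt3 l' l || (n' < n)).

Lemma le3_refl l : le3 l l.
Proof. by rewrite /le3 !leqnn. Qed.

Lemma le3_cat l1' l1 l2' l2 :
  le3 l1' l1 -> le3 l2' l2 -> le3 (l1' ++ l2') (l1 ++ l2).
Proof. by rewrite /le3 !count_cat !size_cat !map_cat !sumn_cat; lia. Qed.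

Lemma lt3_catl l1' l1 l2' l2 :
  lt3 l1' l1 -> le3 l2' l2 -> lt3 (l1' ++ l2') (l1 ++ l2).
Proof. by rewrite /lt3 /le3 !count_cat !size_cat !map_cat !sumn_cat; lia. Qed.

Lemma lt3_catr l1' l1 l2' l2 :
  le3 l1' l1 -> lt3 l2' l2 -> lt3 (l1' ++ l2') (l1 ++ l2).
Proof. by rewrite /lt3 /le3 !count_cat !size_cat !map_cat !sumn_cat; lia. Qed.

Lemma lt3W l' l : lt3 l' l -> le3 l' l.
Proof. by case/andP. Qed.

Lemma lt3_nil v l : lt3 [::] (v :: l).
Proof. by rewrite /lt3 /le3 /=; lia. Qed.

Lemma le3_nil l : le3 [::] l.
Proof. by rewrite /le3 /=; lia. Qed.

Lemma better_lt3 l' n' l n : lt3 l' l -> better l' n' l n.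
Proof. by move=> h; rewrite /better h lt3W. Qed.

Lemma better_cat l1 l' l l2 n1 n' n n2 :
  better l' n' l n ->
  better (l1 ++ l' ++ l2) (n1 + n' + n2) (l1 ++ l ++ l2) (n1 + n + n2).
Proof.
by rewrite /better /lt3 /le3 !count_cat !size_cat !map_cat !sumn_cat; lia.
Qed.

Lemma better_rev l' n' l n : better (rev l') n' (rev l) n = better l' n' l n.
Proof. by rewrite /better /lt3 /le3 !count_rev !size_rev !map_rev !sumn_rev. Qed.

(** * Minimal trails and exchange of a segment *)

Definition opt_in (A : {set V}) (o : option V) : bool :=
  if o is Some v then v \in A else false.

Definition trail_from_to (A B : {set V}) (s : seq V) : bool :=
  [&& sorted (adj e) s, uniq s, opt_in A (hdo None s),
      opt_in B (lasto None s) & active None s None].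

(** As [better] compares cost entries componentwise, this is weaker than lexicographic minimality,
    but it survives reversal and can be refuted on a single segment. *)
Definition minimal (A B : {set V}) (s : seq V) : Prop :=
  trail_from_to A B s /\
  forall s', trail_from_to A B s' ->
    ~~ better (convs None s' None) (size s') (convs None s None) (size s).

Lemma adjC u v : adj e u v = adj e v u.
Proof. by rewrite /adj /= orbC. Qed.

Lemma sorted_adj_rev s : sorted (adj e) (rev s) = sorted (adj e) s.
Proof.
rewrite rev_sorted; case: s => //= x s.
by apply: eq_path => u v; rewrite adjC.
Qed.

Lemma trail_from_to_rev A B s :
  trail_from_to A B s -> trail_from_to B A (rev s).
Proof.
case/and5P => ps us hA hB ac.
by rewrite /trail_from_to sorted_adj_rev rev_uniq hdo_rev lasto_rev active_rev
  ps us hA hB ac.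
Qed.

Lemma minimal_rev A B s : minimal A B s -> minimal B A (rev s).
Proof.
case=> ts hs; split; first exact: trail_from_to_rev.
move=> s' /trail_from_to_rev /hs.
by rewrite !convs_rev !size_rev -{1}(revK (convs None s None)) better_rev.
Qed.

Definition linked (o o' : option V) : bool :=
  if (o, o') is (Some u, Some v) then adj e u v else true.

Lemma sorted_adj_cat s1 s2 :
  sorted (adj e) (s1 ++ s2) =
  [&& sorted (adj e) s1, sorted (adj e) s2
    & linked (lasto None s1) (hdo None s2)].
Proof.
case: s1 => [|u s1]; first by rewrite andbT.
case: s2 => [|v s2] /=; first by rewrite cats0 !andbT.
by rewrite cat_path /=; case: path; rewrite //= andbC.
Qed.

Lemma uniq_middle (P S R : seq V) : uniq (P ++ S ++ R) ->
  {in S, forall v, (v \notin P) && (v \notin R)}.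
Proof.
rewrite !cat_uniq => /and3P [_ /hasPn nP /and3P [_ /hasPn nR _]] v vS.
rewrite (nP v) ?mem_cat ?vS //=; apply/negP => /nR /negP; exact.
Qed.

(** Exchange principle: [P] and [R] keep their contexts because the end nodes facing them are
    unchanged, and [better_cat] carries a gain on the middle piece over to the whole trail. With [R]
    empty, the new piece may end anywhere in [B]. *)
Lemma minimal_segment A B P S R S' :
  minimal A B (P ++ S ++ R) -> S != [::] -> S' != [::] ->
  hdo None S' = hdo None S ->
  lasto None S' = lasto None S \/ R = [::] /\ opt_in B (lasto None S') ->
  sorted (adj e) S' -> uniq S' ->
  {in S', forall v, (v \notin P) && (v \notin R)} ->
  active (lasto None P) S' (hdo None R) ->
  ~~ better (convs (lasto None P) S' (hdo None R)) (size S')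
            (convs (lasto None P) S (hdo None R)) (size S).
Proof.
move=> [tT mT] nS nS' hS lS sS uS dS aS; apply/negP => bS.
have hdE o : hdo o S' = hdo o S.
  by case: (S) (S') nS nS' hS => [|? ?] // [|? ?] //= _ _ [->].
have lastE o : R <> [::] -> lasto o S' = lasto o S.
  case: lS => [lS _|[-> //]].
  by case: (S) (S') nS nS' lS => [|? ?] // [|? ?] //= _ _ [->].
have lastR o : convs (lasto o S') R None = convs (lasto o S) R None.
  by case: (R) lastE => [|v R'] // ->.
have tT' : trail_from_to A B (P ++ S' ++ R).
  case/and5P: tT => sT uT hA hB aT.
  have dPR : {in R, forall v, v \notin P}.
    by move: uT; rewrite cat_uniq => /and3P [_ /hasPn dP _] v vR;
       apply: dP; rewrite mem_cat vR orbT.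
  apply/and5P; split.
  - move: sT; rewrite !sorted_adj_cat !hdo_cat !hdE sS.
    case/and3P => -> /and3P [_ -> lk] ->; rewrite /= andbT.
    case: (R) lastE lk => [|w R'] /= lE; last by rewrite lE.
    by move=> _; rewrite /linked; case: lasto.
  - move: uT; rewrite !cat_uniq uS => /and3P [-> _ /and3P [_ _ ->]].
    rewrite andbT andTb; apply/andP; split.
      apply/hasPn => v; rewrite mem_cat => /orP [/dS /andP []|/dPR] //.
    by apply/hasPn => v vR; apply/negP => /dS; rewrite vR andbF.
  - by move: hA; rewrite !hdo_cat hdE.
  - move: hB; rewrite !lasto_cat; case: (R) lastE lS => [|w R'] //= _.
    case: (S) (S') nS nS' => [|? ?] // [|? ?] //= _ _.
    by case=> [[->]|[]].
  - move: aT; rewrite !active_cat !hdo_cat !hdE aS.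
    case/and3P => -> _ /=; case: (R) lastE => [|w R'] // -> //.
apply: (negP (mT _ tT')).
rewrite !convs_cat !hdo_cat !hdE lastR !size_cat !addnA.
exact: better_cat.
Qed.

(** Otherwise the trail could stop at [a], with fewer nodes and no new converging node. *)
Lemma minimal_interior A B P a S :
  minimal A B (P ++ a :: S) -> S != [::] -> a \notin B.
Proof.
move=> mT nS; apply/negP => aB.
have mT' : minimal A B (P ++ (a :: S) ++ [::]) by rewrite cats0.
case/and5P: (mT.1) => _ uT _ _ _.
apply: (negP (minimal_segment (S' := [:: a]) mT' _ _ _ _ _ _ _ _)) => //.
- by right.
- move=> v; rewrite inE => /eqP ->; rewrite andbT.
  move: uT; rewrite cat_uniq => /and3P [_ /hasPn + _]; apply.
  by rewrite mem_head.
- by case: lasto.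
- rewrite /better.
  have -> : convs (lasto None P) [:: a] (hdo None [::]) = [::].
    by rewrite /convs /=; case: lasto.
  by rewrite le3_nil; case: (S) nS => //= *; rewrite orbT.
Qed.

(** * Directed paths to Z *)

Hypothesis acy : acyclic e.

Lemma acyclic_connect u v : e u v -> connect e v u -> False.
Proof.
move=> euv /connectP [q pq uq].
have := acy (s := v :: q); rewrite /cycle rcons_path pq -uq euv.
by move=> /(_ isT).
Qed.

Lemma acyclic_irr u : e u u = false.
Proof. by apply/negP => /acyclic_connect; apply. Qed.

Lemma acyclic_asym u v : e u v -> e v u -> False.
Proof. by move=> euv /connect1; apply: acyclic_connect. Qed.

Lemma path_connect_last u q : path e u q -> connect e u (last u q).
Proof. by move=> pq; apply/connectP; exists q. Qed.

Lemma acyclic_uniq u q : path e u q -> uniq (u :: q).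
Proof.
elim: q u => [|v q IH] u //= /andP [euv pq]; have := IH _ pq.
rewrite [uniq (v :: q)]/= => /andP [-> ->]; rewrite !andbT.
apply/negP; move: (pq); rewrite -[_ \in _]/(u \in v :: q) => pvq uvq.
apply: (acyclic_connect euv); case/splitPl: uvq pvq => q1 q2 <-.
by rewrite cat_path => /andP [/path_connect_last].
Qed.

Lemma active_conv v z : connect e v z -> z \in Z -> (v |: de e v) :&: Z != set0.
Proof.
move=> /connectP [[|w q] /= pq zE] zZ; apply/set0Pn; exists z.
  by rewrite zE !inE eqxx -zE.
rewrite !inE zZ andbT; apply/orP; right; apply/existsP; exists w.
by case/andP: pq => -> pq; rewrite zE path_connect_last.
Qed.

(** [D] omits the start [a], so it is empty exactly when [a] lies in [Z]. *)
Definition geodesic (a : V) (D : seq V) : Prop :=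
  [/\ path e a D, last a D \in Z
    & forall q, path e a q -> last a q \in Z -> size D <= size q].

Lemma geodesic_exists a : (a |: de e a) :&: Z != set0 -> exists D, geodesic a D.
Proof.
case/set0Pn => z; rewrite !inE => /andP [az zZ].
have caz : connect e a z.
  case/orP: az => [/eqP ->|/existsP [u /andP [eau cuz]]]; first exact: connect0.
  exact: connect_trans (connect1 eau) cuz.
have ex : exists n, [exists q : n.-tuple V, path e a q && (last a q \in Z)].
  case/connectP: caz => q pq zq; exists (size q); apply/existsP.
  by exists (in_tuple q); rewrite /= pq -zq.
case: (ex_minnP ex) => n /existsP [D /andP [pD DZ]] minD.
exists D; split=> // q pq qZ; rewrite size_tuple; apply: minD.
by apply/existsP; exists (in_tuple q); rewrite /= pq.
Qed.

Lemma geodesic_cat a D1 D2 : geodesic a (D1 ++ D2) -> geodesic (last a D1) D2.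
Proof.
case; rewrite cat_path last_cat => /andP [p1 p2] DZ minD; split=> // q pq qZ.
have := minD (D1 ++ q); rewrite cat_path last_cat p1 pq !size_cat leq_add2l.
exact.
Qed.

Lemma geodesic_notin a d D : geodesic a (d :: D) -> a \notin Z.
Proof. by case=> _ _ minD; apply/negP => /(minD [::] isT). Qed.

Lemma geodesic_step a d D v : geodesic a (d :: D) -> v \in D -> ~~ e a v.
Proof.
case=> /= /andP [_ pD] DZ minD vD; apply/negP => eav.
case/splitPr: vD pD DZ minD => D1 D2; rewrite cat_path last_cat /=.
case/and3P => _ _ p2 DZ /(_ (v :: D2)) /=; rewrite eav size_cat /=.
move=> /(_ p2 DZ); lia.
Qed.

(** [size D] counts arcs and [nZ] interior nodes; an empty [D] and a single arc both give 0. *)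
Lemma geodesic_nZ a D : geodesic a D -> nZ e Z a = (size D).-1.
Proof.
rewrite /nZ; case: D => [|d D] gD; first by case: gD => _ /= ->.
rewrite (negPf (geodesic_notin gD)); case: gD => pD DZ minD.
(* A directed path repeats no node, so its length stays within the range searched by [find]. *)
have /= szD : size (a :: d :: D) <= #|V|.
  by rewrite -(card_uniqP (acyclic_uniq pD)) max_card.
have hD : [exists q : (size D).+1.-tuple V, path e a q && (last a q \in Z)].
  by apply/existsP; exists (in_tuple (d :: D)); rewrite pD.
set f := fun n => _.
have hf : has f (iota 0 #|V|).
  by apply/hasP; exists (size D) => //; rewrite mem_iota; apply: ltnW.
have ltf := hf; rewrite has_find size_iota in ltf.
apply/eqP; rewrite eqn_leq; apply/andP; split.
  rewrite leqNgt; apply/negP => /(before_find 0).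
  by rewrite nth_iota ?add0n /f ?hD //; apply: ltnW.
have := nth_find 0 hf; rewrite nth_iota // add0n => /existsP [q /andP [pq qZ]].
by have := minD _ pq qZ; rewrite size_tuple.
Qed.

(* The cost drops either in the number of converging nodes outside Z, if d is
   the last node of the geodesic, or in the distance to Z. *)
Lemma geodesic_lt3 a D d : geodesic a D -> d \in D -> lt3 [:: d] [:: a].
Proof.
move=> gD dD; case/splitPr: dD gD => D1 D2; rewrite -cat_rcons => gD.
have gd := geodesic_cat gD; rewrite last_rcons in gd.
have aZ : a \notin Z by case: (D1) gD => [|? ?] /geodesic_notin.
rewrite /lt3 /le3 /= (geodesic_nZ gD) (geodesic_nZ gd) aZ size_cat size_rcons.
case: (D2) gd => [[_ /= -> _]|d' D2' /geodesic_notin ->] /=; lia.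
Qed.

(** Every node points to its successor ([v] follows the last one), so by asymmetry none converges,
    and avoiding [Z] makes them active. *)
Lemma directed_contexts o a D v :
  path e a (rcons D v) -> {in a :: D, forall u, u \notin Z} ->
  active o (a :: D) (Some v) /\ convs o (a :: D) (Some v) = [::].
Proof.
elim: D o a => [|d D IH] o a.
  rewrite /= andbT => eav /(_ a (mem_head _ _)) aZ.
  rewrite /active /convs /=; case: o => [u|] //=.
  by case: ifP => [/andP [_ eva]|_]; rewrite ?aZ //; case: (acyclic_asym eav eva).
rewrite rcons_cons /= => /andP [ead pd] nZ.
have [|aD cD] := IH (Some a) _ pd.
  by move=> u uD; apply: nZ; rewrite inE uD orbT.
rewrite active_cons convs_cons aD cD andbT cats0.
have eda : e d a = false by apply/negP => /(acyclic_asym ead).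
case: o => [u|] /=; rewrite ?eda ?andbF //; split=> //.
exact/nZ/mem_head.
Qed.

Lemma conv_ctxP o a o' :
  conv_ctx (o, a, o') ->
  exists u h, [/\ o = Some u, o' = Some h, e u a & e h a].
Proof. by case: o o' => [u|] [h|] //= /andP [ua ha]; exists u, h. Qed.

Lemma convs_rcons o s v o' :
  convs o (rcons s v) o' =
  convs o s (Some v) ++ (if conv_ctx (lasto o s, v, o') then [:: v] else [::]).
Proof. by rewrite -cats1 convs_cat /= convs_cons cats0. Qed.

Lemma active_rcons o s v o' :
  active o (rcons s v) o' =
  active o s (Some v) && active_ctx (lasto o s, v, o').
Proof. by rewrite -cats1 active_cat /= active_cons /= andbT. Qed.

Lemma adj_asym u v : adj e u v -> ~~ e u v -> e v u.
Proof. by rewrite /adj /= => /orP [->|]. Qed.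

Lemma geodesic_belast a D1 d D2 :
  geodesic a (D1 ++ d :: D2) -> {in a :: D1, forall u, u \notin Z}.
Proof.
move=> gD u uD; case/splitPl: uD gD => D3 D4 <-; rewrite -catA => gD.
have := geodesic_cat gD; case: (D4) => [|? ?] /=; exact: geodesic_notin.
Qed.

Lemma geodesic_active a D1 d D2 : geodesic a (D1 ++ d :: D2) ->
  (d |: de e d) :&: Z != set0.
Proof.
rewrite -cat_rcons => /geodesic_cat; rewrite last_rcons => -[pD dZ _].
exact: active_conv (path_connect_last pD) dZ.
Qed.

Lemma geodesic_path a D1 D2 : geodesic a (D1 ++ D2) -> path e a D1.
Proof. by case; rewrite cat_path => /andP []. Qed.

Lemma path_adj a s : path e a s -> path (adj e) a s.
Proof. by apply: sub_path => u v; rewrite /adj /= => ->. Qed.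

(** Otherwise follow the geodesic from [a] to [v] instead of the trail. Then [a] points onto the
    geodesic and no longer converges, while [v], should it now converge, is cheaper than [a] by
    [geodesic_lt3]. *)
Lemma geodesic_notin_suffix A B P a S D1 v D2 :
  minimal A B (P ++ a :: S) -> conv_ctx (lasto None P, a, hdo None S) ->
  geodesic a (D1 ++ v :: D2) -> {in D1, forall d, d \notin P ++ a :: S} ->
  v \notin S.
Proof.
move=> mT ca gD dD; apply/negP => vS; case/splitPr: vS => M R in mT ca dD *.
have gD' := gD; rewrite -cat_rcons in gD'.
have pD := geodesic_path gD'.
have mT' : minimal A B (P ++ (a :: rcons M v) ++ R).
  by rewrite /= cat_rcons.
case/and5P: (mT.1) => sT uT _ _ aT.
have uP w : w \in a :: rcons M v -> (w \notin P) && (w \notin R).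
  by case/and5P: mT'.1 => _ /uniq_middle uM _ _ _; apply: uM.
have [aD cD] := directed_contexts (lasto None P) pD (geodesic_belast gD).
have lD : lasto (lasto None P) (a :: D1) = Some (last a D1) by [].
have lM : lasto (lasto None P) (a :: M) = Some (last a M) by [].
have eDv : e (last a D1) v by move: pD; rewrite rcons_path => /andP [].
(* If the successor of [v] does not point to [v], then [v] did not converge on the old trail either
   and so avoids [Z]. If it does, the rest of the geodesic activates [v]. *)
have aM : active_ctx (Some (last a M), v, hdo None R).
  move: aT; rewrite active_cat -[a :: _]/((a :: M) ++ v :: R) active_cat.
  by rewrite active_cons lM => /and4P [].
have cav : connect e a v.
  by have := path_connect_last pD; rewrite last_rcons.
apply: (negP (minimal_segment (S' := a :: rcons D1 v) mT' _ _ _ _ _ _ _ _)) => //.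
- by left; rewrite /= !last_rcons.
- exact: path_adj.
- exact: acyclic_uniq pD.
- move=> w; rewrite inE mem_rcons inE => /or3P [/eqP -> |/eqP ->|/dD].
  + by apply: uP; rewrite mem_head.
  + by apply: uP; rewrite inE mem_rcons mem_head orbT.
  + rewrite !mem_cat !inE !mem_cat !inE !negb_or => /and5P [-> _ _ _ ->] //.
- rewrite -rcons_cons active_rcons aD lD.
  case: (hdo None R) aM => [w|] //=; rewrite eDv /=.
  by case: (e w v); rewrite ?andbF // (geodesic_active gD).
- rewrite -!rcons_cons !convs_rcons cD lD lM cat0s.
  have -> : convs (lasto None P) (a :: M) (Some v) =
            a :: convs (Some a) M (Some v).
    by move: ca; rewrite convs_cons; case: (M) => [|m M'] /= ->.
  apply: better_lt3; rewrite -(cat1s a) -catA.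
  rewrite -[X in lt3 X _]cats0; apply: lt3_catl (le3_nil _).
  have la : lt3 [:: v] [:: a].
    by apply: geodesic_lt3 gD _; rewrite mem_cat mem_head orbT.
  by case: ifP => // _; apply: lt3_nil.
Qed.

Lemma geodesic_notin_trail A B P a S D :
  minimal A B (P ++ a :: S) -> conv_ctx (lasto None P, a, hdo None S) ->
  geodesic a D -> {in D, forall d, d \notin P ++ a :: S}.
Proof.
(* Induction on a prefix [D1] of the geodesic, so that [v] is examined when all nodes before it are
   known to avoid the trail. *)
move=> mT ca gD; move: {-2}D (cats0 D) => D1; move: [::] => D2.
elim/last_ind: D1 D2 => [|D1 v IH] D2 // DE.
rewrite cat_rcons in DE; have dD1 := IH _ DE; rewrite -DE in gD.
move=> d; rewrite mem_rcons inE => /orP [/eqP ->|/dD1 //].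
rewrite mem_cat inE !negb_or; apply/and3P; split.
(* Reversing the trail turns [P] into the suffix. *)
- have mT' : minimal B A (rev S ++ a :: rev P).
    by have := minimal_rev mT; rewrite rev_cat rev_cons cat_rcons.
  have := geodesic_notin_suffix mT' _ gD; rewrite mem_rev; apply.
    by rewrite lasto_rev hdo_rev conv_ctx_sym.
  by move=> w /dD1; rewrite !mem_cat !inE !mem_rev !negb_or => /and3P [-> -> ->].
- apply/eqP => va; case: gD => /acyclic_uniq.
  by rewrite /= va mem_cat mem_head orbT.
- exact: (geodesic_notin_suffix mT ca gD dD1).
Qed.

(** Otherwise the trail could follow the geodesic and stop at a node of [B], which removes the
    converging node [a] and adds none. *)
Lemma geodesic_notin_end A B P a S D :
  minimal A B (P ++ a :: S) -> conv_ctx (lasto None P, a, hdo None S) ->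
  geodesic a D -> {in D, forall d, d \notin B}.
Proof.
move=> mT ca gD d dD; apply/negP => dB.
have nD := geodesic_notin_trail mT ca gD.
case/splitPr: dD gD nD => D1 D2 gD nD.
have gD' := gD; rewrite -cat_rcons in gD'.
have pD := geodesic_path gD'.
have mT' : minimal A B (P ++ (a :: S) ++ [::]) by rewrite cats0.
have [aD cD] := directed_contexts (lasto None P) pD (geodesic_belast gD).
case/and5P: (mT.1) => _ uT _ _ _.
apply: (negP (minimal_segment (S' := a :: rcons D1 d) mT' _ _ _ _ _ _ _ _)) => //.
- by right; rewrite /= last_rcons.
- exact: path_adj.
- exact: acyclic_uniq pD.
- move=> w; rewrite andbT inE => /orP [/eqP ->|wD].
    by move: uT; rewrite cat_uniq => /and3P [_ /hasPn + _]; apply; apply: mem_head.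
  have := nD w; rewrite -cat_rcons mem_cat wD => /(_ isT).
  by rewrite mem_cat negb_or => /andP [].
- by rewrite -rcons_cons active_rcons aD.
- rewrite -rcons_cons convs_rcons cD /=; apply: better_lt3.
  have -> : convs (lasto None P) (a :: S) None = a :: convs (Some a) S None.
    by rewrite convs_cons ca.
  exact: lt3_nil.
Qed.

(** * The walk between two consecutive converging nodes *)

Definition seg_end (o : option V) (a : V) (o' : option V) (D : seq V) : Prop :=
  if conv_ctx (o, a, o') then geodesic a D
  else D = [::] /\ (o = None \/ o' = None).

Lemma seg_end_sym o a o' D : seg_end o a o' D -> seg_end o' a o D.
Proof. by rewrite /seg_end conv_ctx_sym; case: ifP => // _ [-> []]; auto. Qed.

Definition segment (A B : {set V}) (P : seq V) (a : V) (M : seq V) (b : V)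
    (R Da Db : seq V) : Prop :=
  [/\ minimal A B (P ++ a :: M ++ b :: R), convs (Some a) M (Some b) = [::],
      seg_end (lasto None P) a (hdo (Some b) M) Da
    & seg_end (lasto (Some a) M) b (hdo None R) Db].

Definition walk (Da : seq V) (a : V) (M : seq V) (b : V) (Db : seq V) : seq V :=
  rev Da ++ a :: M ++ b :: Db.

Lemma rev_walk Da a M b Db : rev (walk Da a M b Db) = walk Db b (rev M) a Da.
Proof.
by rewrite /walk rev_cat revK rev_cons rev_cat rev_cons -!cats1 -!catA.
Qed.

Lemma size_walk Da a M b Db :
  size (walk Da a M b Db) = size Da + (size M + (size Db).+2).
Proof. by rewrite /walk size_cat /= size_rev size_cat /=; lia. Qed.

Lemma segment_rev A B P a M b R Da Db :
  segment A B P a M b R Da Db -> segment B A (rev R) b (rev M) a (rev P) Db Da.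
Proof.
case=> mT cM ea eb; split.
- have := minimal_rev mT.
  by rewrite rev_cat !rev_cons rev_cat rev_cons -!cats1 -!catA.
- by rewrite convs_rev cM.
- by rewrite lasto_rev hdo_rev; apply: seg_end_sym.
- by rewrite lasto_rev hdo_rev; apply: seg_end_sym.
Qed.

Lemma seg_end_path o a o' D : seg_end o a o' D -> path e a D.
Proof. by rewrite /seg_end; case: ifP => _ [] // ->. Qed.

Lemma segment_notin A B P a M b R Da Db : segment A B P a M b R Da Db ->
  {in Da, forall d, d \notin P ++ a :: M ++ b :: R}.
Proof.
case=> mT _ ea _; move: ea; rewrite /seg_end; case: ifP => [ca gD|_ [-> //]].
by apply: (geodesic_notin_trail mT _ gD); rewrite hdo_cat.
Qed.

Lemma segment_notin_r A B P a M b R Da Db : segment A B P a M b R Da Db ->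
  {in Db, forall d, d \notin P ++ a :: M ++ b :: R}.
Proof.
move=> /segment_rev /segment_notin nD d /nD.
by rewrite !(mem_cat, inE, mem_rev) !negb_or => /and5P [-> -> -> -> ->].
Qed.

(** If the geodesic of [a] first met that of [b] at [v], the piece [a -> ... -> v <- ... <- b] could
    replace the trail between [a] and [b]. Its only converging node [v] is cheaper than the
    converging node [a]. *)
Lemma segment_ends_disjoint A B P a M b R Da Db :
  segment A B P a M b R Da Db -> {in Da, forall d, d \notin Db}.
Proof.
move=> sT; have nDa := segment_notin sT; have nDb := segment_notin_r sT.
case: sT => mT cM; rewrite {1}/seg_end; case: ifP => [ca gDa|_ [-> //]].
rewrite /seg_end; case: ifP => [cb gDb|_ [-> _]]; last by move=> *.
move: {-2}Da (cats0 Da) => D1; move: [::] => D2.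
elim/last_ind: D1 D2 => [|D1 v IH] D2 // DE.
rewrite cat_rcons in DE; have dD1 := IH _ DE; rewrite -DE in gDa.
move=> d; rewrite mem_rcons inE => /orP [/eqP ->|/dD1 //].
have vDa : v \in Da by rewrite -DE mem_cat mem_head orbT.
have sD1 u : u \in D1 -> u \in Da by rewrite -DE mem_cat => ->.
apply/negP => vDb; case/splitPr: vDb gDb nDb dD1 => E1 E2 gDb nDb dD1.
have gDa' := gDa; rewrite -cat_rcons in gDa'.
have gDb' := gDb; rewrite -cat_rcons in gDb'.
have pD := geodesic_path gDa'; have pE := geodesic_path gDb'.
have [aD cD] := directed_contexts (lasto None P) pD (geodesic_belast gDa).
have [aE cE] := directed_contexts (hdo None R) pE (geodesic_belast gDb).
have nE u : u \in E1 -> u \notin P ++ a :: M ++ b :: R.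
  move=> uE; have := nDb u; rewrite mem_cat uE => /(_ isT).
  exact.
case/and5P: (mT.1) => _ uT _ _ _.
have mT' : minimal A B (P ++ (a :: rcons M b) ++ R) by rewrite /= cat_rcons.
have uP w : w \in a :: rcons M b -> (w \notin P) && (w \notin R).
  by case/and5P: mT'.1 => _ /uniq_middle uM _ _ _; apply: uM.
have eDv : e (last a D1) v by move: pD; rewrite rcons_path => /andP [].
have eEv : e (last b E1) v by move: pE; rewrite rcons_path => /andP [].
apply: (negP (minimal_segment (S' := (a :: rcons D1 v) ++ rev (b :: E1))
   mT' _ _ _ _ _ _ _ _)) => //.
- by left; rewrite lasto_cat lasto_rev /= !last_rcons.
- rewrite sorted_adj_cat sorted_adj_rev hdo_rev /= last_rcons.
  rewrite path_adj // path_adj; last by move: pE; rewrite rcons_path => /andP [].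
  by rewrite /linked /adj /= eEv orbT.
- rewrite cat_uniq rev_uniq (acyclic_uniq pD).
  have : uniq (rcons (b :: E1) v) := acyclic_uniq pE.
  rewrite rcons_uniq => /andP [vE ->].
  rewrite andbT andTb; apply/hasPn => u; rewrite mem_rev => uE; apply/negP.
  move=> uD; have uD' : u \in a :: rcons D1 v by []; move: uD'.
  rewrite inE mem_rcons inE => /or3P [/eqP ua|/eqP uv|uD1].
  + move: uE; rewrite ua inE => /orP [/eqP ab|/nE].
      by move: uT; rewrite ab cat_uniq /= mem_cat mem_head orbT !andbF.
    by rewrite mem_cat mem_head orbT.
  + by rewrite uv in uE; rewrite uE in vE.
  + move: uE; rewrite inE => /orP [/eqP ub|uE].
      by have := nDa _ (sD1 _ uD1); rewrite ub !(mem_cat, inE) eqxx !orbT.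
    by have := dD1 _ uD1; rewrite mem_cat uE.
- move=> u; rewrite mem_cat mem_rev inE mem_rcons inE [u \in b :: _]inE.
  case/orP => [/or3P [/eqP ->|/eqP ->|/sD1 /nDa]|/orP [/eqP ->|/nE]].
  + by apply: uP; rewrite mem_head.
  + have := nDa _ vDa; rewrite !(mem_cat, inE) !negb_or.
    by case/and5P => -> _ _ _ ->.
  + by rewrite !(mem_cat, inE) !negb_or; case/and5P => -> _ _ _ ->.
  + by apply: uP; rewrite inE mem_rcons mem_head orbT.
  + by rewrite !(mem_cat, inE) !negb_or; case/and5P => -> _ _ _ ->.
- rewrite active_cat hdo_rev -rcons_cons active_rcons aD.
  have -> : lasto (lasto None P) (rcons (a :: D1) v) = Some v.
    by rewrite /= last_rcons.
  by rewrite active_rev aE /= eDv eEv (geodesic_active gDa).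
- rewrite convs_cat hdo_rev -rcons_cons convs_rcons cD.
  have -> : lasto (lasto None P) (rcons (a :: D1) v) = Some v.
    by rewrite /= last_rcons.
  rewrite convs_rev cE /= cats0 eDv eEv /= convs_cons.
  have -> : hdo (hdo None R) (rcons M b) = hdo (Some b) M by case: (M).
  rewrite ca; apply: better_lt3; rewrite -[X in lt3 X _]cats0.
  apply: lt3_catl (le3_nil _).
  by apply: geodesic_lt3 gDa _; rewrite mem_cat mem_head orbT.
Qed.

Lemma lasto_some a M : lasto (Some a) M = Some (last a M).
Proof. by case: M. Qed.

Lemma hdo_some a M : hdo (Some a) M = Some (head a M).
Proof. by case: M. Qed.

Lemma walk_uniq A B P a M b R Da Db :
  segment A B P a M b R Da Db -> uniq (walk Da a M b Db).
Proof.
move=> sT; have nDa := segment_notin sT; have nDb := segment_notin_r sT.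
have dab := segment_ends_disjoint sT; case: sT => mT _ ea eb.
have := acyclic_uniq (seg_end_path ea); have := acyclic_uniq (seg_end_path eb).
move=> /= /andP [_ uDb] /andP [_ uDa]; case/and5P: mT.1 => _ uT _ _ _.
have uT' : uniq ((a :: rcons M b) ++ R).
  by move: uT; rewrite cat_uniq /= cat_rcons => /and3P [].
have uM : uniq (a :: rcons M b) by move: uT'; rewrite cat_uniq => /and3P [].
rewrite /walk cat_uniq rev_uniq uDa -cat_rcons -cat_cons cat_uniq uDb uM.
rewrite andbT andTb; apply/andP; split; apply/hasPn => u.
  rewrite mem_rev mem_cat inE mem_rcons inE => uW; apply/negP => uDa'.
  have := nDa _ uDa'; rewrite !(mem_cat, inE); case/orP: uW => [/or3P []|uDb'].
  - by move=> ->; rewrite orbT.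
  - by move=> ->; rewrite !orbT.
  - by move=> ->; rewrite !orbT.
  - by have := dab _ uDa'; rewrite uDb'.
move=> /nDb; rewrite !(mem_cat, inE) !negb_or /=.
case/and5P => _ ua uM' ub _.
by rewrite mem_rcons inE negb_or ua uM' ub.
Qed.

Lemma walk_notin A B P a M b R Da Db : segment A B P a M b R Da Db ->
  {in walk Da a M b Db, forall v, (v \notin P) && (v \notin R)}.
Proof.
move=> sT; have nDa := segment_notin sT; have nDb := segment_notin_r sT.
case: sT => mT _ _ _ v.
have mT' : minimal A B (P ++ (a :: rcons M b) ++ R) by rewrite /= cat_rcons.
have uP w : w \in a :: rcons M b -> (w \notin P) && (w \notin R).
  by case/and5P: mT'.1 => _ /uniq_middle uM _ _ _; apply: uM.
rewrite /walk -(cat_rcons b) -cat_cons !mem_cat mem_rev => /or3P [/nDa|/uP //|/nDb].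
  by rewrite !(mem_cat, inE) !negb_or => /and5P [-> _ _ _ ->].
by rewrite !(mem_cat, inE) !negb_or => /and5P [-> _ _ _ ->].
Qed.

Lemma walk_sorted A B P a M b R Da Db :
  segment A B P a M b R Da Db -> sorted (adj e) (walk Da a M b Db).
Proof.
case=> mT _ ea eb; case/and5P: mT.1 => sT _ _ _ _.
have pM : path (adj e) a (rcons M b).
  move: sT; rewrite sorted_adj_cat => /and3P [_ + _].
  by rewrite -(cat_rcons b) /= cat_path => /andP [].
rewrite /walk -(cat_rcons b) sorted_adj_cat sorted_adj_rev lasto_rev /=.
rewrite cat_path pM last_rcons (path_adj (seg_end_path eb)) /=.
have := path_adj (seg_end_path ea); case: (Da) => //= d D /andP [ad ->].
by rewrite /linked adjC ad.
Qed.

Lemma directed_convs o a D : path e a D -> convs o (a :: D) None = [::].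
Proof.
elim: D o a => [|d D IH] o a /=; first by rewrite /convs /=; case: o.
case/andP => ead /IH; rewrite convs_cons => ->; case: o => [u|] //=.
by case: ifP => // /andP [_ /(acyclic_asym ead)].
Qed.

(** At [a], a nonempty [Da] begins with an arc leaving [a], and with [Da] empty [a] is an end of the
    walk; likewise at [b]. *)
Lemma walk_convs A B P a M b R Da Db :
  segment A B P a M b R Da Db -> convs None (walk Da a M b Db) None = [::].
Proof.
case=> _ cM /seg_end_path pa /seg_end_path pb.
rewrite /walk -cat_rcons -rev_cons convs_cat convs_rev directed_convs //.
by rewrite convs_cat lasto_rev cM directed_convs.
Qed.

Section Indices.
Variables (s : seq V) (x0 : V).
Hypotheses (ss : sorted (adj e) s) (cs : convs None s None = [::]).
Local Notation w := (nth x0 s).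

Lemma nth_adj k : k.+1 < size s -> adj e (w k) (w k.+1).
Proof. by move=> lk; apply: (sortedP x0 _). Qed.

Lemma nth_no_conv k : k.+2 < size s -> ~~ (e (w k) (w k.+1) && e (w k.+2) (w k.+1)).
Proof.
move: cs; move: {1}None => o c.
elim: (s) o c k => [|u [|v [|x s']] IH] o c [|k] //= lk.
  move/nilP: c; rewrite convs_cons cat_nilp convs_cons cat_nilp /=.
  by case/and3P => _ + _; case: ifP.
apply: (IH (Some u)) => //.
by move/nilP: c; rewrite convs_cons cat_nilp => /andP [_ /nilP].
Qed.

(** A forward arc followed by a backward one would make a node converge, so forward arcs propagate
    to the right. *)
Lemma nth_forward k l : e (w k) (w k.+1) -> k < l < size s ->
  e (w l.-1) (w l) /\ connect e (w k.+1) (w l).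
Proof.
move=> ek /andP [+ ls]; elim: l ls => // l IH ls.
rewrite ltnS leq_eqVlt => /orP [/eqP <-|kl]; first by [].
have [el cl] := IH (ltnW ls) kl.
have ls' : l < size s := ltnW ls.
have := nth_no_conv (k := l.-1); have lE : l = l.-1.+1 by lia.
rewrite -lE => /(_ ls); rewrite el /= => nl.
have := adj_asym (u := w l.+1) (v := w l); rewrite adjC => /(_ (nth_adj ls) nl) h.
by split=> //; apply: connect_trans cl (connect1 h).
Qed.

Lemma nth_backward k l : k.+1 < size s -> e (w k.+1) (w k) -> l <= k ->
  e (w l.+1) (w l) /\ connect e (w k) (w l).
Proof.
move=> ks ek lk; rewrite -(subKn lk); elim: (k - l) => [|m [IHe IHc]].
  by rewrite subn0.
have [mk|mk] := leqP k m.
  by move: IHe IHc; have -> : k - m = k - m.+1 by lia.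
have := nth_no_conv (k := k - m.+1); have <- : k - m = (k - m.+1).+1 by lia.
have lt1 : (k - m).+1 < size s by lia.
move=> /(_ lt1); rewrite IHe andbT => nl.
have lt2 : (k - m.+1).+1 < size s by lia.
have := adj_asym (nth_adj lt2); have <- : k - m = (k - m.+1).+1 by lia.
move=> /(_ nl) h; split=> //; exact: connect_trans IHc (connect1 h).
Qed.
End Indices.

(** * Contexts and positions *)

Lemma contexts_nth x0 o s o' :
  contexts o s o' =
  [seq (lasto o (take j s), nth x0 s j, hdo o' (drop j.+1 s))
     | j <- iota 0 (size s)].
Proof.
elim: s o => [|v s IH] o //=; rewrite drop0; congr (_ :: _).
rewrite IH (iotaDl 1 0) -map_comp; apply/eq_in_map => j.
rewrite mem_iota add0n /= => lj; congr (_, _, _).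
by rewrite lasto_some; case: take.
Qed.

(** Links recursive contexts to positions. The end nodes have a [None] in their context, so the
    values of [c0] and [c1] do not matter for convergence or activation. *)
Lemma contexts_interior x p :
  exists c0 c1, contexts None (x :: p) None =
    (None, x, c0) :: [seq (Some (node x p j.-1), node x p j, Some (node x p j.+1))
                        | j <- interior p] ++
    (if p is [::] then [::] else [:: (c1, last x p, None)]).
Proof.
exists (hdo None p), (Some (last x (take (size p).-1 p))).
rewrite (contexts_nth x) /interior /= drop0; congr (_ :: _).
case/lastP: p => [|p y] //; rewrite size_rcons -[(size p).+1.-1]/(size p).
have -> : iota 1 (size p).+1 = iota 1 (size p) ++ [:: (size p).+1].
  by rewrite -(addn1 (size p)) iotaD /= add1n addn1.
rewrite map_cat.
have -> T (z : T) l : (if rcons p y is [::] then l else [:: z]) = [:: z].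
  by case: (p).
rewrite /= last_rcons nth_rcons ltnn eqxx drop_oversize ?size_rcons //.
congr (_ ++ _); apply/eq_in_map => -[|j]; rewrite mem_iota //= => lj.
rewrite /node /= (drop_nth x) ?size_rcons //=; congr (_, _, _).
case: j lj => [|j] lj; first by rewrite take0.
congr Some.
by rewrite (take_nth x) ?size_rcons ?last_rcons //; lia.
Qed.

Lemma convs_node x p :
  convs None (x :: p) None = [seq node x p j | j <- conv_pos e x p].
Proof.
have [c0 [c1 E]] := contexts_interior x p.
rewrite /convs E /= filter_cat map_cat /conv_pos.
have -> : [seq t.1.2 | t <- if p is [::] then [::] else [:: (c1, last x p, None)]
             & conv_ctx t] = [::].
  by case: (p) => //= *; case: c1 {E}.
by rewrite cats0 filter_map -map_comp.
Qed.

Lemma activatedE x p : activated e Z x p = active None (x :: p) None.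
Proof.
have [c0 [c1 E]] := contexts_interior x p.
rewrite /active E /= all_cat all_map.
have -> : all active_ctx (if p is [::] then [::] else [:: (c1, last x p, None)]).
  by case: (p) => //= *; case: c1 {E}.
by rewrite andbT; apply: eq_all => j.
Qed.

Lemma no_convergingE x p :
  no_converging e x p = nilp (convs None (x :: p) None).
Proof.
rewrite convs_node /nilp size_map /conv_pos size_filter /no_converging.
by rewrite eqn0Ngt -has_count -all_predC; apply: eq_all.
Qed.

(** * Cycles without chords *)

Lemma nth_next (s : seq V) x0 k : uniq s -> k.+1 < size s ->
  next s (nth x0 s k) = nth x0 s k.+1.
Proof.
move=> us lk; rewrite next_nth mem_nth ?(ltnW lk) //.
case: s us lk => [|y s] // us lk; rewrite index_uniq ?(ltnW lk) //=.
exact: set_nth_default.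
Qed.

Lemma next_last (s : seq V) x0 : uniq (x0 :: s) ->
  next (x0 :: s) (last x0 s) = x0.
Proof.
move=> us; rewrite next_nth mem_last (last_nth x0) index_uniq //.
by rewrite nth_default.
Qed.

Section Fan.
Variables (s : seq V) (x0 : V).
Hypotheses (nac : ~ has_active_cycle e) (us : uniq s).
Hypotheses (ss : sorted (adj e) s) (cs : convs None s None = [::]).
Local Notation w := (nth x0 s).
Hypothesis e10 : e (w 1) (w 0).
(** The condition [0 < i] leaves arcs out of [w 0] as the only possible chords. *)
Hypothesis no_chord : forall i j, i.+1 < j < size s ->
  ~~ e (w j) (w i) /\ (0 < i -> ~~ e (w i) (w j)).

(* If w_0 -> w_j but not w_0 -> w_(j-1), the last k < j with w_0 and w_k
   adjacent closes the active cycle w_j, w_0, w_k, ..., w_(j-1). *)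
Lemma fan_step j : 2 < j < size s -> e (w 0) (w j) -> e (w 0) (w j.-1).
Proof.
move=> /andP [j2 js] e0j; apply/negPn/negP => ne0.
have inj i l : i < size s -> l < size s -> w i = w l -> i = l.
  by move=> li ll /eqP; rewrite nth_uniq // => /eqP.
have exk : exists k, (0 < k < j.-1) && adj e (w 0) (w k).
  (* Position 1 qualifies by [e10], and [2 < j] places it below [j.-1]. *)
  by exists 1; rewrite /adj /= e10 orbT; nat_lia.
have ubk k : (0 < k < j.-1) && adj e (w 0) (w k) -> k <= j by nat_lia.
case: (ex_maxnP exk ubk) => k /andP [/andP [k0 kj] ak] maxk {exk ubk}.
have nadj i : k < i < j -> ~~ adj e (w 0) (w i).
  move=> /andP [ki ij]; apply/negP => ai; have [ij'|ij'] := ltnP i j.-1.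
    have i0 : 0 < i by nat_lia.
    by have := maxk i; rewrite ai ij' i0 => /(_ isT); rewrite leqNgt ki.
  have iE : i = j.-1 by nat_lia.
  move: ai; rewrite iE /adj /= (negPf ne0) /=; apply/negP.
  by have [|] := @no_chord 0 j.-1; first nat_lia.
set q := drop k (take j s).
have szq : size q = j - k by rewrite size_drop size_takel // ltnW.
have nthq y m : m < j - k -> nth y q m = w (k + m).
  move=> lm; rewrite (set_nth_default x0) ?szq // nth_drop nth_take //; nat_lia.
have qE : q = rcons (take (j.-1 - k) q) (w j.-1).
  apply: (@eq_from_nth _ x0); first by rewrite size_rcons size_takel szq; nat_lia.
  move=> m; rewrite szq => lm; rewrite nth_rcons size_takel ?szq; last by nat_lia.
  case: ltnP => lm'; first by rewrite nth_take.
  have -> : m = j.-1 - k by nat_lia.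
  by rewrite eqxx nthq; [congr nth; nat_lia | nat_lia].
have memq u : u \in q -> exists2 i, k <= i < j & u = w i.
  move=> /(nthP x0) [m]; rewrite szq => lm <-; exists (k + m); first nat_lia.
  by rewrite nthq.
have uc : uniq [:: w j, w 0 & q].
  have uq : uniq q by rewrite drop_uniq // take_uniq.
  rewrite /= uq andbT inE negb_or -andbA; apply/and3P; split.
  - by apply/eqP => /inj; nat_lia.
  - by apply/negP => /memq [i li /inj]; nat_lia.
  - by apply/negP => /memq [i li /inj]; nat_lia.
(* The opposite arc would continue backwards to [w 0] and close a directed cycle with [e0j]. *)
have ezj : e (w j.-1) (w j).
  have lj : j.-1.+1 < size s by nat_lia.
  have := nth_adj x0 ss lj; rewrite (ltn_predK j2) => /orP [] // ejz.
  have := nth_backward (x0 := x0) ss cs lj; rewrite (ltn_predK j2) => /(_ 0 ejz (leq0n _)).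
  case=> _ cz; case: (acyclic_connect e0j).
  exact: connect_trans (connect1 ejz) cz.
have hd0 : nth x0 q 0 = w k by rewrite nthq ?addn0 //; nat_lia.
have pq : path (adj e) (w 0) q.
  have : sorted (adj e) q by rewrite drop_sorted // take_sorted.
  by move: hd0; case: (q) => [|u q'] //= -> ->; rewrite ak.
(* [q] lists positions [k] to [j.-1]; its last entry is the second parent, and the others are the
   inner nodes. *)
apply: nac; exists (w j), (w 0), (w j.-1), (take (j.-1 - k) q).
rewrite -qE; split; first split=> //.
- by apply/eqP => /inj; nat_lia.
- by rewrite -size_eq0 size_takel ?szq; nat_lia.
- split; first by rewrite /trail pq; move: uc => /= /andP [_ ->].
  apply/allP => i; rewrite mem_iota szq => li.
  rewrite /converging /node.
  case: i li => [|[|i]] // li /=.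
    rewrite !nthq ?addn0; [|nat_lia|nat_lia]; rewrite addn1.
    have lk : k.+1 < size s by nat_lia.
    (* The left neighbour of [w k] is now [w 0], so [cs] does not apply; an arc into [w k] from the
       right would continue backwards to [w 0]. *)
    apply/negP => /andP [e0k ek]; have [_ ck] := nth_backward ss cs lk ek (leq0n _).
    exact: acyclic_connect e0k ck.
  rewrite !nthq; [|nat_lia|nat_lia|nat_lia]; rewrite !addnS.
  by apply: (nth_no_conv x0 cs); nat_lia.
set c := [:: w j, w 0 & q] in uc *.
have nj : next c (w j) = w 0.
  by rewrite -[LHS]/(next c (nth x0 c 0)) nth_next //= szq; nat_lia.
have n0 : next c (w 0) = w k.
  by rewrite -[w 0]/(nth x0 c 1) nth_next //= szq; nat_lia.
have ni i : k <= i -> i.+1 < j -> next c (w i) = w i.+1.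
  move=> ki ij; have -> : w i = nth x0 c (i - k).+2.
    by rewrite /= nthq; [congr nth; nat_lia | nat_lia].
  rewrite nth_next //= ?szq; last by nat_lia.
  by rewrite nthq; [congr nth; nat_lia | nat_lia].
have nz : next c (w j.-1) = w j.
  have -> : w j.-1 = last (w j) [:: w 0 & q] by rewrite /= qE last_rcons.
  exact: next_last.
have memc u : u \in c -> [\/ u = w j, u = w 0 | exists2 i, k <= i < j & u = w i].
  by rewrite !inE => /or3P [/eqP ->|/eqP ->|/memq]; [apply: Or31|apply: Or32|apply: Or33].
(* Chords between [w 0] and [q] are excluded by [nadj], the others by [no_chord], and wrong
   directions by acyclicity. *)
split=> // a b /memc am /memc bm eab; apply/orP.
case: am eab => [->|->|[i /andP [ki ij] ->]]; case: bm => [->|->|[l /andP [kl lj] ->]] eab.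
- by rewrite acyclic_irr in eab.
- by case: (acyclic_asym eab).
- have [lz|lz] := eqVneq l j.-1; first by rewrite lz in eab; case: (acyclic_asym eab).
  by have [|/negP []] := @no_chord l j; first nat_lia.
- by right; rewrite nj.
- by rewrite acyclic_irr in eab.
- have [lk|lk] := eqVneq l k; first by left; rewrite n0 lk.
  by have /negP [] := nadj l ltac:(nat_lia); rewrite /adj /= eab.
- have [iz|iz] := eqVneq i j.-1; first by left; rewrite iz nz.
  by have [|_ /(_ _)/negP []] := @no_chord i j; [nat_lia | nat_lia |].
- have [ik|ik] := eqVneq i k; first by right; rewrite n0 ik.
  by have /negP [] := nadj i ltac:(nat_lia); rewrite /adj /= eab orbT.
- have [il|li|il] := ltngtP i l.
  + have [il'|il'] := eqVneq l i.+1; first by left; rewrite il' ni //; nat_lia.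
    by have [|_ /(_ _)/negP []] := @no_chord i l; [nat_lia | nat_lia |].
  + have [il'|il'] := eqVneq i l.+1; first by right; rewrite il' ni //; nat_lia.
    by have [|/negP []] := @no_chord l i; first nat_lia.
  + by rewrite il acyclic_irr in eab.
Qed.

(** [fan_step] descends from the last node to position 2. A backward arc out of [w j] would lead to
    [w 0] and close a directed cycle. *)
Lemma fan j : 1 < j < size s -> e (w 0) (last x0 s) ->
  e (w 0) (w j) /\ e (w j.-1) (w j).
Proof.
move=> /andP [j1 js]; rewrite (last_nth x0) => e0N.
have e0j : e (w 0) (w j).
  have lE : nth x0 (x0 :: s) (size s) = w (size s).-1 by case: (s) js.
  rewrite lE in e0N; rewrite -(subKn (n := (size s).-1) (m := j)); last by nat_lia.
  have : (size s).-1 - j <= (size s).-1 - 2 by nat_lia.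
  elim: (_ - j) => [|m IH] lm; first by rewrite subn0.
  have -> : (size s).-1 - m.+1 = ((size s).-1 - m).-1 by nat_lia.
  by apply: fan_step; [nat_lia | apply: IH; nat_lia].
split=> //; have lj : j.-1.+1 < size s by nat_lia.
have := nth_adj x0 ss lj; rewrite (ltn_predK j1) => /orP [] // ejz.
have := nth_backward (x0 := x0) ss cs lj; rewrite (ltn_predK j1) => /(_ 0 ejz (leq0n _)).
case=> _ cz; case: (acyclic_connect e0j).
exact: connect_trans (connect1 ejz) cz.
Qed.
End Fan.

(** * Chords of the walk *)

(** For a chord leaving the geodesic before its end: the nodes so far avoid [Z] and none converges,
    so the cost of [a] is saved. If [a] does not converge, it is an end of the trail and [D1] is
    empty. *)
Lemma ascent_out o a h D1 D2 v :
  seg_end o a (Some h) (D1 ++ D2) -> e (last a D1) v ->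
  (conv_ctx (o, a, Some h) -> D2 <> [::]) ->
  [/\ active o (a :: D1) (Some v),
      le3 (convs o (a :: D1) (Some v)) (convs o [:: a] (Some h))
    & conv_ctx (o, a, Some h) ->
      lt3 (convs o (a :: D1) (Some v)) (convs o [:: a] (Some h))].
Proof.
rewrite /seg_end [convs o [:: a] _]convs_cons [hdo _ _]/=.
case: ifP => [_ gD ev /(_ isT) nD2|_ [DE oE] _ _].
  case: D2 nD2 gD => // d D2 _ gD.
  have pD : path e a (rcons D1 v) by rewrite rcons_path (geodesic_path gD).
  have [aD cD] := directed_contexts o pD (geodesic_belast gD).
  by rewrite aD cD; split=> // _; apply: lt3_nil.
by case: oE => // ->; case: D1 DE.
Qed.

(** For a chord entering the geodesic of a converging [a]: the entry node converges in place of [a],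
    at a lower cost unless it is [a] itself. *)
Lemma ascent_in o a h D1 D2 v :
  seg_end o a (Some h) (D1 ++ D2) -> e v (last a D1) ->
  [/\ active o (a :: D1) (Some v),
      le3 (convs o (a :: D1) (Some v)) (convs o [:: a] (Some h))
    & D1 <> [::] ->
      lt3 (convs o (a :: D1) (Some v)) (convs o [:: a] (Some h))].
Proof.
rewrite /seg_end [convs o [:: a] _]convs_cons [hdo _ _]/=.
case: ifP => [ca gD ev|_ [DE oE] _]; last first.
  by case: oE => // ->; case: D1 DE.
have [u [h' [oE _ eua _]]] := conv_ctxP ca; rewrite oE in ca *.
case/lastP: D1 gD ev => [|D1 d] gD ev.
  rewrite active_cons convs_cons /= eua ev /= le3_refl; split=> //.
  case: gD => pD DZ _; rewrite andbT.
  exact: active_conv (path_connect_last pD) DZ.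
rewrite cat_rcons in gD; have gD' := gD; rewrite -cat_rcons in gD'.
have pD := geodesic_path gD'.
have [aD cD] := directed_contexts (Some u) pD (geodesic_belast gD).
have := pD; rewrite rcons_path => /andP [_ ed]; rewrite last_rcons in ev.
rewrite -rcons_cons active_rcons convs_rcons aD cD /= ed ev /=.
have lt : lt3 [:: d] [:: a].
  by apply: geodesic_lt3 gD _; rewrite mem_cat mem_head orbT.
by rewrite (geodesic_active gD) (lt3W lt).
Qed.

(** The trail is left at the inner node [m] towards [v]. As [m] did not converge before, it avoids
    [Z], so it stays active if it does not converge now. *)
Lemma inner_piece o a M0 m M2 b v :
  active o (a :: M0 ++ m :: M2) (Some b) ->
  convs (Some a) (M0 ++ m :: M2) (Some b) = [::] ->
  ~~ conv_ctx (Some (last a M0), m, Some v) ->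
  active o (a :: rcons M0 m) (Some v) /\
  convs o (a :: rcons M0 m) (Some v) =
  convs o [:: a] (hdo (Some b) (M0 ++ m :: M2)).
Proof.
have hE x : hdo x (M0 ++ m :: M2) = hdo (Some m) M0 by case: (M0).
rewrite -cat_cons active_cat convs_cat [hdo _ (m :: _)]/= => /andP [aM0 am].
move=> /nilP; rewrite cat_nilp => /andP [/nilP cM0 /nilP cm] nc.
rewrite -!rcons_cons active_rcons convs_rcons aM0 (negPf nc) cats0 hE.
rewrite convs_cons cM0 cats0 convs_cons cats0; split=> //=.
move: am cm nc; rewrite active_cons convs_cons lasto_some hdo_some /=.
case: ifP => // _ /andP [mZ _] _.
by rewrite /conv_ctx => /negPf ->.
Qed.

Section Pieces.
Variables (A B : {set V}) (P : seq V) (a : V) (M : seq V) (b : V).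
Variables (R Da Db : seq V) (x0 : V).
Hypothesis sT : segment A B P a M b R Da Db.
Local Notation w := (nth x0 (walk Da a M b Db)).
Local Notation la := (size Da).
Local Notation conv_a := (conv_ctx (lasto None P, a, hdo (Some b) M)).
Local Notation cost_a := (convs (lasto None P) [:: a] (hdo (Some b) M)).

Lemma nth_take_last k (D : seq V) c : k <= size D ->
  nth x0 (c :: D) k = last c (take k D).
Proof.
move=> kD; rewrite (last_nth x0) size_takel //.
by rewrite -[c :: take k D]/(take k.+1 (c :: D)) nth_take.
Qed.

Lemma walk_ascent i : i <= la -> w i = last a (take (la - i) Da).
Proof.
move=> li; rewrite /walk -cat_rcons -rev_cons nth_cat size_rev /= ltnS li.
by rewrite nth_rev //= subSS nth_take_last // leq_subr.
Qed.

Lemma walk_inner i : la < i <= la + size M -> w i = last a (take (i - la) M).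
Proof.
move=> /andP [li iM]; rewrite /walk nth_cat size_rev ltnNge ltnW //=.
rewrite -cat_cons nth_cat /= (_ : i - la < (size M).+1); last by nat_lia.
by rewrite nth_take_last //; nat_lia.
Qed.

(** [L] leads from [a] to [w i], along the geodesic if [i <= la] and along the trail otherwise. The
    last two clauses bound its cost before a chord leaving or entering [w i]. Leaving [w 0] is
    excluded for a converging [a], since this node lies in [Z] and would block the trail. *)
Lemma left_piece i : i <= la + size M ->
  exists L, [/\ hdo None L = Some a /\ lasto None L = Some (w i),
    [/\ uniq L, sorted (adj e) L
      & {subset L <= take (maxn la i).+1 (walk Da a M b Db)}],
    la <= i -> size L = (i - la).+1,
    forall v, e (w i) v -> (conv_a -> 0 < i) ->
      [/\ active (lasto None P) L (Some v),
          le3 (convs (lasto None P) L (Some v)) cost_a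
        & conv_a -> i <= la -> lt3 (convs (lasto None P) L (Some v)) cost_a]
  & forall v, e v (w i) -> (la < i -> e (w i) (w i.-1)) ->
      [/\ active (lasto None P) L (Some v),
          le3 (convs (lasto None P) L (Some v)) cost_a
        & i < la -> lt3 (convs (lasto None P) L (Some v)) cost_a]].
Proof.
move=> li; have [mT cM ea eb] := sT.
have [lai|lai] := leqP i la.
  rewrite (hdo_some b M) in ea *.
  have pa := seg_end_path ea; rewrite -(cat_take_drop (la - i) Da) in ea pa.
  have {}pa : path e a (take (la - i) Da) by move: pa; rewrite cat_path => /andP [].
  have szt : size (take (la - i) Da) = la - i by rewrite size_takel // leq_subr.
  rewrite (walk_ascent lai); exists (a :: take (la - i) Da); split=> //.
  - split; [exact: acyclic_uniq | exact: path_adj |].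
    move=> u; rewrite /walk -cat_rcons -rev_cons.
    rewrite take_size_cat ?size_rev // mem_rev !inE.
    by case/orP => [->|/mem_take ->]; rewrite ?orbT.
  - by move=> ila; rewrite /= szt; nat_lia.
  - move=> v ev ci; have [|h1 h2 h3] := ascent_out ea ev.
    + move=> /ci i0 dE; have := size_drop (la - i) Da.
      by rewrite dE /=; nat_lia.
    by split=> // /h3.
  - move=> v ev _; have [h1 h2 h3] := ascent_in ea ev; split=> // ila.
    by apply: h3 => tE; move: szt; rewrite tE /=; nat_lia.
have wi : w i = last a (take (i - la) M) by apply: walk_inner; nat_lia.
have wi1 : w i.-1 = last a (take (i.-1 - la) M).
  have [la1|la1] := leqP i.-1 la; last by apply: walk_inner; nat_lia.
  have z1 : la - i.-1 = 0 by nat_lia.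
  have z2 : i.-1 - la = 0 by nat_lia.
  by rewrite walk_ascent // z1 z2 !take0.
have iM : i.-1 - la < size M by nat_lia.
set M0 := take (i.-1 - la) M in wi1.
have szM0 : size M0 = i.-1 - la by rewrite size_takel //; nat_lia.
have takeE : take (i - la) M = rcons M0 (nth a M (i.-1 - la)).
  by rewrite -take_nth //; congr take; nat_lia.
have ME : M = M0 ++ nth a M (i.-1 - la) :: drop (i.-1 - la).+1 M.
  by rewrite -drop_nth // cat_take_drop.
rewrite takeE last_rcons in wi; rewrite -wi in takeE ME.
move: (w i) (w i.-1) wi1 takeE ME => m m' -> takeE ME {wi}.
have ME' : M = rcons M0 m ++ drop (i.-1 - la).+1 M by rewrite cat_rcons.
have aM : active (lasto None P) (a :: M) (Some b).
  case/and5P: mT.1 => _ _ _ _.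
  by rewrite active_cat -cat_cons active_cat => /and3P [].
have pM : path (adj e) a (rcons M0 m).
  case/and5P: mT.1 => + _ _ _ _; rewrite sorted_adj_cat => /and3P [_ + _].
  by rewrite ME' -catA /= cat_path => /andP [].
have uM : uniq (a :: rcons M0 m).
  case/and5P: mT.1 => _ + _ _ _; rewrite cat_uniq => /and3P [_ _].
  by rewrite ME' -catA -cat_cons cat_uniq => /andP [].
have piece v : ~~ conv_ctx (Some (last a M0), m, Some v) ->
    active (lasto None P) (a :: rcons M0 m) (Some v) /\
    convs (lasto None P) (a :: rcons M0 m) (Some v) = cost_a.
  move=> nc; have := inner_piece (o := lasto None P) (a := a) (b := b) _ _ nc.
  by move=> /(_ (drop (i.-1 - la).+1 M)); rewrite -ME; apply.
exists (a :: rcons M0 m); split.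
- by rewrite /= last_rcons.
- split=> // u uL; rewrite /walk ME' -catA.
  rewrite -cat_cons catA take_size_cat.
    by rewrite mem_cat uL orbT.
  by rewrite size_cat size_rev /= size_rcons szM0; nat_lia.
- by rewrite /= size_rcons szM0; nat_lia.
- move=> v ev _; have [|h1 ->] := piece v.
    by rewrite /= andbC; case: (boolP (e v m)) => // /acyclic_asym -/(_ ev).
  by split=> //; exact: le3_refl.
- move=> v ev /(_ isT) em; have [|h1 ->] := piece v.
    by rewrite /=; case: (boolP (e (last a M0) m)) => // /acyclic_asym -/(_ em).
  by split=> //; [exact: le3_refl | rewrite ltnNge ltnW].
Qed.
End Pieces.

Lemma geodesic_nth x0 a D k l : geodesic a D -> k.+1 < l <= size D ->
  ~~ e (nth x0 (a :: D) k) (nth x0 (a :: D) l).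
Proof.
elim: D a k l => [|d D IH] a k l gD /andP [kl ls]; first by case: l kl ls.
case: k kl => [|k] kl; last first.
  have gd : geodesic d D := geodesic_cat (D1 := [:: d]) gD.
  by case: l kl ls => // l kl ls; apply: (IH d); rewrite // -ltnS kl.
case: l kl ls => [|[|l]] // _ ls; apply: geodesic_step gD _.
exact: mem_nth.
Qed.

(** Such a chord would shorten the geodesic of [a] if both nodes lie on it, and close a directed
    cycle if both lie on the path from [b]. Otherwise the pieces from [a] to [w i] and from [b] to
    [w j], joined by the chord, form a better segment, unless [w j] is the end in [Z] of the
    geodesic of a converging [b]. *)
Lemma chord_back A B P a M b R Da Db x0 i j :
  segment A B P a M b R Da Db ->
  i.+1 < j < size (walk Da a M b Db) ->
  e (nth x0 (walk Da a M b Db) j) (nth x0 (walk Da a M b Db) i) ->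
  j.+1 = size (walk Da a M b Db) /\ conv_ctx (lasto (Some a) M, b, hdo None R).
Proof.
move=> sT /andP [ij js] eji.
have sT' := segment_rev sT; have [mT cM ea eb] := sT.
have uW := walk_uniq sT; have nW := walk_notin sT.
have sW := walk_sorted sT; have cW := walk_convs sT.
have szW := size_walk Da a M b Db.
have revW := rev_walk Da a M b Db.
set w := nth x0 (walk Da a M b Db) in eji *.
have [jla|jla] := leqP j (size Da).
  move: eji; rewrite /w !walk_ascent //; last by nat_lia.
  rewrite -!(nth_take_last x0) ?leq_subr // => ekl.
  move: ea; rewrite /seg_end; case: ifP => [_ gD|_ [DE _]]; last first.
    by move: jla; rewrite DE /=; nat_lia.
  have kl : (size Da - j).+1 < size Da - i <= size Da by nat_lia.
  by rewrite (negPf (geodesic_nth x0 gD kl)) in ekl.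
have [iM|iM] := leqP i (size Da + size M); last first.
  have revE k : size Da + size M < k < size (walk Da a M b Db) ->
      exists2 l, l <= size Db & w k = last b (take l Db) /\
        k = l + (size Da + size M).+1.
    move=> /andP [k1 k2]; exists (k - (size Da + size M).+1); first by nat_lia.
    split; last by nat_lia.
    set k' := (size (walk Da a M b Db)).-1 - k.
    have wk : nth x0 (walk Db b (rev M) a Da) k' = w k.
      by rewrite -revW nth_rev /w; [congr nth|]; rewrite /k'; nat_lia.
    rewrite -wk walk_ascent; last by rewrite /k'; nat_lia.
    by congr (last b (take _ _)); rewrite /k'; nat_lia.
  have [|l l1 [wl lE]] := revE i; first by nat_lia.
  have [|m m1 [wm mE]] := revE j; first by nat_lia.
  case: (acyclic_connect eji); rewrite wl wm.
  have lm : l <= m by nat_lia.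
  have := take_path m (seg_end_path eb); rewrite -(take_takel Db lm).
  rewrite -[in path _ _ _](cat_take_drop l (take m Db)) cat_path => /andP [_ p].
  rewrite -[in last b (take m Db)](cat_take_drop l (take m Db)) last_cat.
  exact: path_connect_last p.
pose i' := (size (walk Da a M b Db)).-1 - j.
have wi' : nth x0 (walk Db b (rev M) a Da) i' = w j.
  by rewrite -revW nth_rev /w; [congr nth|]; rewrite /i'; nat_lia.
have li' : i' <= size Db + size (rev M) by rewrite size_rev /i'; nat_lia.
have [L [[hL lL] [uL sL subL] szL _ inL]] := left_piece x0 sT iM.
have [K [[hK lK] [uK sK subK] szK outK _]] := left_piece x0 sT' li'.
rewrite wi' in lK outK; rewrite -/w in lL inL.
have {inL} [|aL leL ltL] := inL _ eji.
  (* A forward arc into [w i] would continue to [w j] and close a directed cycle with the chord. *)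
  move=> lai; have wE : i = i.-1.+1 by nat_lia.
  have li1 : i.-1.+1 < size (walk Da a M b Db) by rewrite -wE; nat_lia.
  have := nth_adj x0 sW li1; rewrite -wE /adj /= => /orP [ei|//].
  have := nth_forward (x0 := x0) sW cW (k := i.-1) (l := j); rewrite -wE => /(_ ei).
  case; first by nat_lia.
  by move=> _ /(acyclic_connect eji).
have [/andP [/eqP jE cb]|nb] :=
  boolP ((j.+1 == size (walk Da a M b Db))
         && conv_ctx (lasto (Some a) M, b, hdo None R)); first by [].
have cbE : conv_ctx (lasto None (rev R), b, hdo (Some a) (rev M)) =
           conv_ctx (lasto (Some a) M, b, hdo None R).
  by rewrite lasto_rev hdo_rev conv_ctx_sym.
rewrite cbE in outK.
have {outK} [|aK leK ltK] := outK _ eji.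
  by move=> cb; rewrite cb andbT in nb; rewrite /i'; nat_lia.
have lLo o : lasto o L = Some (w i) by case: (L) hL lL.
have lKo o : lasto o K = Some (w j) by case: (K) hK lK.
have nL : L != [::] by case: (L) hL.
have nK : K != [::] by case: (K) hK.
have mT' : minimal A B (P ++ (a :: rcons M b) ++ R) by rewrite /= cat_rcons.
have subW u : u \in L ++ rev K -> u \in walk Da a M b Db.
  rewrite mem_cat mem_rev => /orP [/subL /mem_take //|/subK /mem_take].
  by rewrite -revW mem_rev.
exfalso; apply: (negP (minimal_segment (S' := L ++ rev K) mT' _ _ _ _ _ _ _ _)) => //.
- by case: (L) nL.
- by rewrite hdo_cat; case: (L) hL => //= ? ? [->].
- left; rewrite lasto_cat lasto_rev /= last_rcons.
  by case: (K) hK => //= ? ? [->].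
- rewrite sorted_adj_cat sorted_adj_rev sL sK hdo_rev lL lK /=.
  by rewrite /linked /adj /= eji orbT.
- rewrite cat_uniq rev_uniq uL uK andbT; apply/hasPn => u; rewrite mem_rev.
  move=> /subK; rewrite -revW take_rev mem_rev => uK'; apply/negP => /subL uL'.
  have := uW; rewrite -(cat_take_drop (maxn (size Da) i).+1 (walk _ _ _ _ _)).
  rewrite cat_uniq => /and3P [_ /hasPn + _] => /(_ u); rewrite /= uL' => /(_ _)/negP; apply=> //.
  (* [L] lies among the first [q2] nodes of the walk and [K] among those from position [q1] on, with
     [q2 <= q1]. *)
  move: uK'; set q1 := _ - _; set q2 := (maxn _ _).+1.
  have -> : q1 = q1 - q2 + q2.
    by rewrite subnK // /q1 /q2 szW; case: (leqP (size Da) i);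
       case: (leqP (size Db) i'); rewrite /i'; nat_lia.
  by rewrite -drop_drop => /mem_drop.
- by move=> u /subW /nW.
- by move: aK; rewrite active_cat hdo_rev lKo lLo active_rev aL lasto_rev.
rewrite convs_cat hdo_rev lKo lLo convs_rev.
have -> : convs (lasto None P) (a :: rcons M b) (hdo None R) =
  convs (lasto None P) [:: a] (hdo (Some b) M) ++
  rev (convs (lasto None (rev R)) [:: b] (hdo (Some a) (rev M))).
  rewrite -[a :: _]/([:: a] ++ rcons M b) convs_cat -cats1 hdo_cat.
  by rewrite convs_cat cM lasto_rev hdo_rev -convs_rev.
have leLK := le3_cat leL leK.
have rv l l' : le3 l l' = le3 (rev l) (rev l').
  by rewrite /le3 !count_rev !size_rev !map_rev !sumn_rev.
have rvt l l' : lt3 l l' = lt3 (rev l) (rev l').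
  by rewrite /lt3 -rv !count_rev !size_rev !map_rev !sumn_rev.
rewrite lasto_rev in leK ltK leLK *.
(* The gain is a cheaper list of converging nodes on the [a] side, a converging node saved on the
   [b] side, or, if both pieces follow the trail, fewer nodes because [i.+1 < j]. *)
have [ila|ila] := ltnP i (size Da).
  by apply/better_lt3/lt3_catl; [exact: ltL | rewrite -rv].
have [/andP [cb i'b]|nb'] :=
    boolP (conv_ctx (lasto (Some a) M, b, hdo None R) && (i' <= size Db)).
  by apply/better_lt3/lt3_catr; [| rewrite -rvt; exact: ltK].
rewrite /better le3_cat // -?rv //; apply/orP; right.
have i'b : size Db <= i'.
  case/nandP: nb' => [ncb|]; last by rewrite -ltnNge => /ltnW.
  by move: eb; rewrite /seg_end (negPf ncb) => -[-> _].
rewrite size_cat size_rev szL // szK //= size_rcons /i'; nat_lia.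
Qed.

(** * Adjacency of the ends of the walk and the resulting arcs *)

Lemma inner_notin o a M b : active o (a :: M) (Some b) ->
  convs (Some a) M (Some b) = [::] -> {in M, forall m, m \notin Z}.
Proof.
move=> aM cM m mM; case/splitPr: mM aM cM => M0 M2.
rewrite -cat_cons active_cat convs_cat => /andP [_ am].
move=> /nilP; rewrite cat_nilp => /andP [_ /nilP cm].
move: am cm; rewrite active_cons convs_cons lasto_some hdo_some /=.
by case: ifP => // _ /andP [].
Qed.

Lemma geodesic_inner a D u : geodesic a D -> u \in a :: D -> u != last a D ->
  u \notin Z.
Proof.
move=> gD uD ul; case/splitPl: uD gD ul => D1 [|d D2] uE gD.
  by rewrite cats0 uE eqxx.
by move=> _; rewrite -uE; apply: geodesic_notin (geodesic_cat gD).
Qed.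

(** Local relationships apply to the walk: its inner nodes avoid [B] by minimality, and [Z] because
    geodesics are shortest and the trail is active. *)
Lemma ends_adjacent A B P a M b R Da Db :
  local_relationships e (B :|: Z) -> segment A B P a M b R Da Db ->
  conv_ctx (lasto None P, a, hdo (Some b) M) ->
  R = [::] \/ conv_ctx (lasto (Some a) M, b, hdo None R) ->
  adj e (last a Da) (last b Db).
Proof.
move=> lr sT ca cb; have [mT cM ea eb] := sT.
have uW := walk_uniq sT; have sW := walk_sorted sT; have cW := walk_convs sT.
move: ea; rewrite /seg_end ca => gDa.
have mTb : minimal A B ((P ++ a :: M) ++ b :: R) by rewrite -catA.
have lPM : lasto None (P ++ a :: M) = lasto (Some a) M.
  by rewrite lasto_cat /= lasto_some.
have aM : active (lasto None P) (a :: M) (Some b).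
  case/and5P: mT.1 => _ _ _ _.
  by rewrite active_cat -cat_cons active_cat => /and3P [].
have gDb : conv_ctx (lasto (Some a) M, b, hdo None R) -> geodesic b Db.
  by move: eb; rewrite /seg_end => + c; rewrite c.
have nDb : ~~ conv_ctx (lasto (Some a) M, b, hdo None R) -> Db = [::].
  by move: eb; rewrite /seg_end => + c; rewrite (negPf c) => -[].
have [xs WE] : exists xs, walk Da a M b Db = last a Da :: rcons xs (last b Db).
  rewrite /walk -cat_rcons -rev_cons lastI rev_rcons /=.
  by rewrite [b :: Db]lastI -rcons_cat -rcons_cat; eexists.
have nP : P <> [::] by move=> PE; move: ca; rewrite PE.
apply: lr (xs) _ _ _ _ _.
- by rewrite inE; case: gDa => _ -> _; rewrite orbT.
- rewrite inE; have [/gDb [_ -> _]|/[dup] ncb /nDb DE] :=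
    boolP (conv_ctx (lasto (Some a) M, b, hdo None R)); first by rewrite orbT.
  case: cb => [RE|cb]; last by rewrite cb in ncb.
  case/and5P: mT.1 => _ _ _ + _.
  by rewrite RE DE /= lasto_cat /= last_cat /= => ->.
- by rewrite /trail -WE uW andbT; rewrite WE in sW.
- by rewrite no_convergingE -WE cW.
move=> u ux; have uW' : u \in walk Da a M b Db.
  by rewrite WE inE mem_rcons inE ux !orbT.
move: uW; rewrite WE /= mem_rcons inE negb_or rcons_uniq -!andbA.
case/and4P => _ nz1 nz2 _.
have u1 : u != last a Da by apply: contraNneq nz1 => <-.
have u2 : u != last b Db by apply: contraNneq nz2 => <-.
have inb : u \in b :: Db -> (u \notin B) && (u \notin Z).
  move=> ub; have c : conv_ctx (lasto (Some a) M, b, hdo None R).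
    apply/negPn/negP => /nDb DE; move: ub u2.
    by rewrite DE inE => /eqP ->; rewrite eqxx.
  rewrite (geodesic_inner (gDb c)) // andbT; move: ub; rewrite inE.
  case/orP => [/eqP ->|]; last first.
    by apply: (geodesic_notin_end mTb _ (gDb c)); rewrite lPM.
  apply: (minimal_interior mTb); apply/eqP => RE; move: c.
  by rewrite RE; case: lasto.
rewrite inE negb_or; move: uW'; rewrite /walk mem_cat mem_rev inE mem_cat.
have ain : u \in a :: Da -> (u \notin B) && (u \notin Z).
  move=> ua; rewrite (geodesic_inner gDa) // andbT; move: ua; rewrite inE.
  case/orP => [/eqP ->|].
    by apply: (minimal_interior mT); case: (M).
  by apply: (geodesic_notin_end mT _ gDa); rewrite hdo_cat.
case/or4P => [uD|ua|uM|/inb //].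
- by apply: ain; rewrite inE uD orbT.
- by apply: ain; rewrite inE ua.
rewrite (inner_notin aM cM uM) andbT; case/splitPr: uM mT => M0 M2 mT.
have mT' : minimal A B ((P ++ a :: M0) ++ u :: (M2 ++ b :: R)).
  by move: mT; rewrite -!catA.
by apply: (minimal_interior mT'); case: (M2).
Qed.

(** The walk satisfies the hypotheses of [fan]: convergence at [a] orients its first arc, and
    [chord_back] in both reading directions controls the chords. With [Da] nonempty, the arc between
    positions 1 and 2 would have both directions. *)
Lemma segment_core A B P a M b R Da Db x0 :
  ~ has_active_cycle e -> segment A B P a M b R Da Db ->
  conv_ctx (lasto None P, a, hdo (Some b) M) ->
  e (last a Da) (last b Db) ->
  let t := nth x0 (a :: rcons M b) in
  [/\ Da = [::], e a b, forall j, 1 <= j <= size M -> e (t j) (t j.+1)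
    & forall j, 2 <= j <= size M -> e a (t j)].
Proof.
move=> nac sT ca eab t; have [mT cM ea eb] := sT; have sT' := segment_rev sT.
have uW := walk_uniq sT; have sW := walk_sorted sT; have cW := walk_convs sT.
have szW := size_walk Da a M b Db; have revW := rev_walk Da a M b Db.
set W := walk Da a M b Db in uW sW cW szW revW.
have [u [h [_ hE _ eha]]] := conv_ctxP ca.
have w0E : nth x0 W 0 = last a Da by rewrite walk_ascent // subn0 take_size.
have wNE : nth x0 W (size W).-1 = last b Db.
  by rewrite nth_last /W /walk last_cat /= last_cat.
have waE : nth x0 W (size Da) = a by rewrite walk_ascent // subnn take0.
have whE : nth x0 W (size Da).+1 = h.
  rewrite /W /walk nth_cat size_rev ltnNge leqnSn /= subSnn /=.
  by move: hE; case: (M) => [|m M'] /= [->].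
have desc k : k <= size Da -> e (nth x0 W k.+1) (nth x0 W k).
  move=> kla; have l1 : (size Da).+1 < size W by nat_lia.
  have e1 : e (nth x0 W (size Da).+1) (nth x0 W (size Da)) by rewrite waE whE.
  by have [] := nth_backward sW cW l1 e1 kla.
have chord i j : i.+1 < j < size W ->
    ~~ e (nth x0 W j) (nth x0 W i) /\ (0 < i -> ~~ e (nth x0 W i) (nth x0 W j)).
  move=> ij; split; last first.
    (* A forward chord is a backward chord of the reversed walk, where [chord_back] forces its tail
       to be position 0 here. *)
    move=> i0; apply/negP => eij.
    have := chord_back (x0 := x0) (i := (size W).-1 - j) (j := (size W).-1 - i) sT'.
    rewrite -revW size_rev !nth_rev; [|by nat_lia|by nat_lia].
    case; first by nat_lia.
      move: eij; congr (is_true (e _ _)); congr nth; nat_lia.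
    by nat_lia.
  (* The tail must be the last node. Forward arcs from [w i] lead back to it; backward ones lead to
     [w 0], which points to it by [eab]. *)
  apply/negP => eji; have [jE _] := chord_back sT ij eji.
  have jE' : j = (size W).-1 by rewrite -jE.
  rewrite jE' wNE in eji; have il : i.+1 < size W by nat_lia.
  have [ei|ei] := boolP (e (nth x0 W i) (nth x0 W i.+1)).
    have [|_] := nth_forward (l := (size W).-1) sW cW ei; first by nat_lia.
    rewrite wNE => c; apply: (acyclic_connect eji).
    exact: connect_trans (connect1 ei) c.
  have ei' := adj_asym (nth_adj x0 sW il) ei.
  have [_] := nth_backward (l := 0) sW cW il ei' (leq0n _).
  rewrite w0E => c; apply: (acyclic_connect eji).
  exact: connect_trans c (connect1 eab).
have W1 : e (nth x0 W 1) (nth x0 W 0) := desc 0 (leq0n _).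
have e0N : e (nth x0 W 0) (last x0 W).
  by rewrite -nth_last wNE w0E.
have F j : 1 < j < size W -> e (nth x0 W 0) (nth x0 W j) /\ e (nth x0 W j.-1) (nth x0 W j).
  by move=> lj; apply: fan.
have DE : Da = [::].
  case: (posnP (size Da)) => [/size0nil //|la0].
  have [|_] := F 2; first by nat_lia.
  by move=> e12; case: (acyclic_asym (desc 1 la0) e12).
have tE j : j <= (size M).+1 -> nth x0 W j = t j.
  move=> lj; rewrite /W /walk DE /= -cat_rcons -cat_cons nth_cat /= size_rcons.
  by rewrite ltnS lj.
have w0a : nth x0 W 0 = a by rewrite w0E DE.
split=> //.
- have [M0|M0] := posnP (size M).
    have ME := size0nil M0; move: eb; rewrite ME /seg_end /=.
    case: ifP => [|_ [DbE _]]; last by move: eab; rewrite DE DbE.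
    by case: hdo => // ? /andP [].
  have [|] := F (size M).+1; first by nat_lia.
  by rewrite w0a tE // /t /= nth_rcons ltnn eqxx.
- move=> j lj; have [|_] := F j.+1; first by nat_lia.
  by rewrite /= !tE //; nat_lia.
- move=> j lj; have [|+ _] := F j; first by nat_lia.
  by rewrite w0a tE //; nat_lia.
Qed.

Lemma mem_convs_ctx P a S : uniq (P ++ a :: S) ->
  (a \in convs None (P ++ a :: S) None) =
  conv_ctx (lasto None P, a, hdo None S).
Proof.
rewrite cat_uniq /= => /and3P [_ /norP [aP _] /andP [aS _]].
have aP' o o' : a \in convs o P o' = false by apply: contraNF aP; apply: mem_convs.
have aS' o o' : a \in convs o S o' = false by apply: contraNF aS; apply: mem_convs.
rewrite convs_cat convs_cons !mem_cat aP' aS' orbF.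
by case: ifP; rewrite ?mem_head.
Qed.

Lemma conv_geodesic A B P a S : minimal A B (P ++ a :: S) ->
  conv_ctx (lasto None P, a, hdo None S) -> exists D, geodesic a D.
Proof.
move=> mT ca; apply: geodesic_exists; case/and5P: mT.1 => _ _ _ _.
rewrite active_cat active_cons => /and3P [_ + _].
by have [u [h [-> -> /= -> ->]]] := conv_ctxP ca.
Qed.

(** The direction of the arc between the ends of the walk decides: [segment_core] applies to the
    segment or to its reversal. *)
Lemma segment_shape A B P a M b R x0 :
  ~ has_active_cycle e -> local_relationships e (B :|: Z) ->
  minimal A B (P ++ a :: M ++ b :: R) -> convs (Some a) M (Some b) = [::] ->
  conv_ctx (lasto None P, a, hdo (Some b) M) ->
  R = [::] \/ conv_ctx (lasto (Some a) M, b, hdo None R) ->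
  let t := nth x0 (a :: rcons M b) in
  let n := size M in
  [/\ R = [::] -> a \in Z, (a \in Z) || (b \in Z) &
    [/\ e a b, e (t 1) a, forall j, 1 <= j <= n -> e (t j) (t j.+1)
      & forall j, 2 <= j <= n -> e a (t j)]
    \/
    [/\ e b a, e (t 1) a, forall j, 1 <= j <= n.-1 -> e (t j.+1) (t j),
        1 <= n -> e (t n) b & forall j, 1 <= j <= n.-1 -> e b (t j)]].
Proof.
move=> nac lr mT cM ca cb t n.
have [Da gDa] : exists D, geodesic a D.
  by apply: (conv_geodesic mT); rewrite hdo_cat.
have [Db eb] : exists Db, seg_end (lasto (Some a) M) b (hdo None R) Db.
  have [c|nc] := boolP (conv_ctx (lasto (Some a) M, b, hdo None R)); last first.
    exists [::]; rewrite /seg_end (negPf nc); split=> //; right.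
    by case: cb nc => [->|->].
  have mTb : minimal A B ((P ++ a :: M) ++ b :: R) by rewrite -catA.
  have [|D gD] := conv_geodesic mTb; first by move: c; rewrite lasto_cat lasto_some.
  by exists D; rewrite /seg_end c.
have sT : segment A B P a M b R Da Db by split=> //; rewrite /seg_end ca.
have sT' := segment_rev sT.
have t1a : e (t 1) a.
  have [u [h [_ + _]]] := conv_ctxP ca.
  by rewrite /t; case: (M) => [|m M'] /= [->].
have := ends_adjacent lr sT ca cb; rewrite /adj /= => /orP [zab|zba].
  have [DE ab h1 h2] := segment_core x0 nac sT ca zab.
  have aZ : a \in Z by move: gDa; rewrite DE => -[].
  by rewrite aZ; split=> //; left.
(* If [b] ends the trail and is the tail of this arc, [chord_back] forbids the arc as a chord, so it
   is the whole walk. *)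
case: cb => [RE|cb].
  have lc := chord_back (x0 := a) (i := 0) (j := (size (walk Da a M b Db)).-1) sT.
  have DbE : Db = [::] by move: eb; rewrite RE /seg_end; case: (lasto _ _) => [?|] /= [].
  have szW := size_walk Da a M b Db.
  have sz2 : size Da + size M = 0.
    apply/eqP; rewrite -leqn0 leqNgt; apply/negP => pos.
    have [||_] := lc; first by nat_lia.
      rewrite nth_last walk_ascent // subn0 take_size /walk last_cat /= last_cat.
      exact: zba.
    by rewrite RE; case: lasto.
  have DE : Da = [::] by apply: size0nil; nat_lia.
  have ME : M = [::] by apply: size0nil; nat_lia.
  have aZ : a \in Z by move: gDa; rewrite DE => -[].
  rewrite aZ; split=> //; right; rewrite /n ME /=.
  by rewrite DE DbE in zba; split=> // -[].
have cb' : conv_ctx (lasto None (rev R), b, hdo (Some a) (rev M)).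
  by rewrite lasto_rev hdo_rev conv_ctx_sym.
have [DE ba h1 h2] := segment_core x0 nac sT' cb' zba.
have bZ : b \in Z by move: eb; rewrite /seg_end cb DE => -[].
have tE j : j <= n.+1 -> nth x0 (b :: rcons (rev M) a) j = t (n.+1 - j).
  move=> lj; have -> : b :: rcons (rev M) a = rev (a :: rcons M b).
    by rewrite rev_cons rev_rcons.
  by rewrite nth_rev /= size_rcons // subSS.
rewrite bZ orbT; split=> //; first by move=> RE; move: cb; rewrite RE; case: lasto.
right; split=> //.
- move=> j lj; have := h1 (n - j); rewrite size_rev.
  rewrite !tE; [|by nat_lia|by nat_lia].
  have -> : n.+1 - (n - j) = j.+1 by nat_lia.
  have -> : n.+1 - (n - j).+1 = j by nat_lia.
  by apply; rewrite -/n; nat_lia.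
- move=> n1; have [u [h [+ _ eub _]]] := conv_ctxP cb.
  rewrite lasto_some => -[uE]; rewrite -uE (last_nth x0) in eub.
  by rewrite /t -rcons_cons nth_rcons /= ltnS leqnn.
- move=> j lj; have := h2 (n.+1 - j); rewrite size_rev tE; last by nat_lia.
  have -> : n.+1 - (n.+1 - j) = j by nat_lia.
  by apply; rewrite -/n; nat_lia.
Qed.

(** * Positions of the converging nodes and the cost vector *)

Lemma pos_path x p : 0 < size p -> path ltn 0 (rcons (conv_pos e x p) (size p)).
Proof.
move=> p0; rewrite -cats1 cat_path /= andbT; apply/andP; split.
  have : path ltn 0 (interior p).
    exact: (iota_ltn_sorted 0 (size p).-1.+1).
  by apply: path_filter; apply: ltn_trans.
have : all (fun j => j < size p) (0 :: conv_pos e x p).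
  rewrite /= p0; apply/allP => j; rewrite mem_filter mem_iota => /andP [_ lj].
  by nat_lia.
by move/allP; apply; apply: mem_last.
Qed.

Lemma pos_lt x p i k : 0 < size p -> i < k <= (nconv e x p).+1 ->
  pos e x p i < pos e x p k.
Proof.
move=> p0 /andP [ik kC]; have := pos_path x p0.
have E j : pos e x p j = nth (size p) (0 :: rcons (conv_pos e x p) (size p)) j.
  rewrite /pos; case: j => //= j; rewrite nth_rcons.
  by case: ltngtP => // [/ltnW jC|->]; exact: nth_default.
move=> sp; rewrite !E; apply: (sorted_ltn_nth ltn_trans) => //.
- by rewrite inE /= size_rcons; apply: ltn_trans ik _.
- by rewrite inE /= size_rcons.
Qed.

Lemma pos_last x p : pos e x p (nconv e x p).+1 = size p.
Proof. by rewrite /pos /= nth_default. Qed.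

(** The gaps between consecutive positions telescope. For a fixed number of converging nodes, the
    last cost entry thus measures the length of the trail. *)
Lemma sum_nt x p : 0 < size p ->
  \sum_(0 <= i < (nconv e x p).+1) nt e x p i + (nconv e x p).+1 = size p.
Proof.
move=> p0; rewrite -[RHS](pos_last x).
suff H k : k <= (nconv e x p).+1 ->
  \sum_(0 <= i < k) nt e x p i + k = pos e x p k by apply: H.
elim: k => [|k IH] lk; first by rewrite big_nil.
have := pos_lt (x := x) p0 (i := k) (k := k.+1); rewrite ltnSn lk => /(_ isT).
have := IH (ltnW lk); rewrite big_nat_recr //= /nt; nat_lia.
Qed.

(** The nodes being distinct, the cardinal in the first entry becomes a count over a list. *)
Lemma trail_vectorE x p : uniq (x :: p) ->
  trail_vector e Z x p =
  [:: count [predC Z] (convs None (x :: p) None); size (convs None (x :: p) None);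
      sumn (map (nZ e Z) (convs None (x :: p) None));
      \sum_(0 <= i < (nconv e x p).+1) nt e x p i].
Proof.
move=> up; rewrite /trail_vector convs_node.
congr [:: _; _; _; _]; last 2 first.
- by rewrite size_map.
- rewrite sumnE !big_map big_add1 /= [RHS](big_nth (size p)); apply: eq_bigr => i _.
  by [].
rewrite -convs_node; set L := convs _ _ _.
have uL : uniq L.
  rewrite /L convs_node map_inj_in_uniq ?filter_uniq ?iota_uniq //.
  move=> i j; rewrite !mem_filter !mem_iota => /andP [_ li] /andP [_ lj] /eqP.
  by rewrite /node nth_uniq ?/= => // [/eqP//||]; nat_lia.
rewrite -size_filter -(card_uniqP (filter_uniq _ uL)).
by apply: eq_card => c; rewrite !inE mem_filter.
Qed.

(** [better] implies a lexicographic decrease: if the first three entries agree, [sum_nt] turns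
    fewer nodes into a smaller fourth entry. Disjointness gives every trail an arc, as [sum_nt]
    requires. *)
Lemma minimal_trail_minimal (X Y : {set V}) x p : [disjoint X & Y] ->
  minimal_trail e X Y Z x p -> minimal X Y (x :: p).
Proof.
move=> dXY [tT mT].
have TE x' p' : trail_from_to X Y (x' :: p') = TRAILS e X Y Z x' p'.
  by rewrite /trail_from_to /TRAILS /trail activatedE -!andbA.
have p0 x' p' : TRAILS e X Y Z x' p' -> 0 < size p'.
  case: p' => // /and4P [_ xX xY _].
  by rewrite (disjointFr dXY xX) in xY.
split; first by rewrite TE.
case=> // x' p'; rewrite TE => tT'; apply: contra (mT _ _ tT').
have up : uniq (x :: p) by case/and4P: tT => /andP [].
have up' : uniq (x' :: p') by case/and4P: tT' => /andP [].
rewrite /trail_lt !trail_vectorE //.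
have := sum_nt x (p0 _ _ tT); have := sum_nt x' (p0 _ _ tT').
have sE y q : nconv e y q = size (convs None (y :: q) None).
  by rewrite convs_node size_map.
rewrite !sE /better /lt3 /le3.
move: (\sum_(_ <= _ < _) _) (\sum_(_ <= _ < _) _) => n' n.
rewrite !Order.SeqLexiOrder.ltxi_cons /= !Order.NatOrder.leEnat.
nat_lia.
Qed.

(** * The shape of a minimal trail *)

Lemma cat_take_nth2 (s : seq V) x0 k l : k < l < size s ->
  s = take k s ++ nth x0 s k :: take (l - k.+1) (drop k.+1 s) ++
      nth x0 s l :: drop l.+1 s.
Proof.
move=> /andP [kl ls]; rewrite -{1}(cat_take_drop k s); congr (_ ++ _).
rewrite (drop_nth x0) ?(ltn_trans kl) //; congr (_ :: _).
rewrite -{1}(cat_take_drop (l - k.+1) (drop k.+1 s)); congr (_ ++ _).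
by rewrite drop_drop subnK // (drop_nth x0).
Qed.

Lemma mem_convs_node (x : V) (p : seq V) q : uniq (x :: p) -> q <= size p ->
  (node x p q \in convs None (x :: p) None) = (q \in conv_pos e x p).
Proof.
move=> up qp; rewrite convs_node; apply/mapP/idP => [[r rp /eqP]|]; last by exists q.
have lr : r <= size p.
  by move: rp; rewrite mem_filter mem_iota => /andP [_ ?]; nat_lia.
by rewrite /node nth_uniq // => /eqP ->.
Qed.

Lemma pos_mem x p i : 0 < i <= nconv e x p -> pos e x p i \in conv_pos e x p.
Proof. by case: i => // i /andP [_ iC]; apply: mem_nth. Qed.

Lemma pos_between (x : V) (p : seq V) i q : 0 < size p -> i <= nconv e x p ->
  pos e x p i < q < pos e x p i.+1 -> q \notin conv_pos e x p.
Proof.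
move=> p0 iC /andP [iq qi]; apply/negP => /(nthP (size p)) [r rC rE].
have {}rE : pos e x p r.+1 = q by [].
have rC' : r < nconv e x p by [].
have [ri|ri|ri] := ltngtP r.+1 i.
- have lri : r.+1 < i <= (nconv e x p).+1 by nat_lia.
  by have := pos_lt p0 lri; rewrite rE; nat_lia.
- have [rE'|nri] := eqVneq r i; first by rewrite -rE rE' ltnn in qi.
  have lri : i.+1 < r.+1 <= (nconv e x p).+1 by nat_lia.
  by have := pos_lt p0 lri; rewrite rE; nat_lia.
- by rewrite -rE ri ltnn in iq.
Qed.

(** Splits the trail at two consecutive converging nodes (or the last one and [y]) and translates
    [segment_shape] back to positions. *)
Lemma minimal_trail_shape (X Y : {set V}) (x : V) (p : seq V) i :
  ~ has_active_cycle e -> local_relationships e (Y :|: Z) ->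
  [disjoint X & Y] -> minimal_trail e X Y Z x p ->
  1 <= i <= nconv e x p ->
  let c := cnode e x p in
  let t := tnode e x p i in
  let n := nt e x p i in
  [/\ i = nconv e x p -> c i \in Z, (c i \in Z) || (c i.+1 \in Z) &
    [/\ e (c i) (c i.+1), e (t 1) (c i),
        forall j, 1 <= j <= n -> e (t j) (t j.+1)
      & forall j, 2 <= j <= n -> e (c i) (t j)]
    \/
    [/\ e (c i.+1) (c i), e (t 1) (c i),
        forall j, 1 <= j <= n.-1 -> e (t j.+1) (t j),
        1 <= n -> e (t n) (c i.+1)
      & forall j, 1 <= j <= n.-1 -> e (c i.+1) (t j)]].
Proof.
move=> nac lr dXY mp /andP [i1 iC] c t n.
have mT := minimal_trail_minimal dXY mp.
have up : uniq (x :: p) by case/and5P: mT.1.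
have p0 : 0 < size p.
  case: mp => /and4P [_ xX + _] _; case: (p) => // /= xY.
  by rewrite (disjointFr dXY xX) in xY.
have k0 : 0 < pos e x p i by have := pos_lt (x := x) p0 (i := 0) (k := i); apply; nat_lia.
have kl : pos e x p i < pos e x p i.+1 by apply: pos_lt => //; nat_lia.
have lp : pos e x p i.+1 <= size p.
  rewrite -[leqRHS](pos_last x); have [->//|iC'] := eqVneq i (nconv e x p).
  by apply/ltnW/pos_lt => //; nat_lia.
have kls : pos e x p i < pos e x p i.+1 < size (x :: p) by rewrite kl /= ltnS.
have sE := cat_take_nth2 x kls.
rewrite -/(node x p _) -/(node x p _) -/(cnode e x p i) -/(cnode e x p i.+1) in sE.
set P := take _ _ in sE; set M := take _ _ in sE; set R := drop _ _ in sE.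
have szM : size M = n.
  rewrite size_takel; first by rewrite /n /nt subnS.
  by rewrite size_drop /=; nat_lia.
have szP : size P = pos e x p i by rewrite size_takel //= ; nat_lia.
have nE q : q <= size p -> node x p q = nth x (P ++ c i :: M ++ c i.+1 :: R) q.
  by rewrite /node {1}sE.
have tE j : j <= n.+1 -> t j = nth x (c i :: rcons M (c i.+1)) j.
  move=> lj; rewrite /t /tnode /node sE nth_cat szP ltnNge leq_addr /= addKn.
  by rewrite -cat_rcons -cat_cons nth_cat /= size_rcons szM ltnS lj.
have ci : conv_ctx (lasto None P, c i, hdo (Some (c i.+1)) M).
  have := mem_convs_node (q := pos e x p i) up; rewrite pos_mem ?i1 //.
  rewrite -/(cnode e x p i) {1}sE mem_convs_ctx -?sE // hdo_cat.
  by apply; nat_lia.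
have cR : R = [::] \/ conv_ctx (lasto (Some (c i)) M, c i.+1, hdo None R).
  have [iE|iE] := eqVneq i (nconv e x p).
    by left; rewrite /R iE pos_last drop_oversize.
  right; have := mem_convs_node (q := pos e x p i.+1) up.
  rewrite pos_mem; last by nat_lia.
  have sE' : x :: p = (P ++ c i :: M) ++ c i.+1 :: R by rewrite sE -catA.
  rewrite -/(cnode e x p i.+1) {1}sE' mem_convs_ctx -?sE' // lasto_cat lasto_some.
  by apply.
have cM : convs (Some (c i)) M (Some (c i.+1)) = [::].
  (* A converging node in [M] would have a position strictly between two consecutive values of
     [pos]. *)
  case E: convs => [|m L] //.
  have mM : m \in convs (Some (c i)) M (Some (c i.+1)) by rewrite E mem_head.
  have mC : m \in convs None (x :: p) None.
    by rewrite sE convs_cat convs_cons convs_cat !mem_cat mM !orbT.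
  have [r rM rE] := nthP x (mem_convs mM).
  have rn : r < n by rewrite -szM.
  have mE : m = node x p (pos e x p i + r.+1).
    rewrite -/(tnode e x p i r.+1) -/(t _) tE /= ?ltnS 1?ltnW //.
    by rewrite nth_rcons rM rE.
  have ql : pos e x p i < pos e x p i + r.+1 < pos e x p i.+1.
    by move: rn; rewrite /n /nt; nat_lia.
  rewrite mE mem_convs_node // in mC; last by nat_lia.
  by rewrite (negPf (pos_between p0 iC ql)) in mC.
have mT' : minimal X Y (P ++ c i :: M ++ c i.+1 :: R) by rewrite -sE.
have [aZ abZ shape] := segment_shape x nac lr mT' cM ci cR.
split=> //.
  by move=> iE; apply: aZ; rewrite /R iE pos_last drop_oversize.
rewrite szM in shape.
case: shape => [[h1 h2 h3 h4]|[h1 h2 h3 h4 h5]]; [left|right]; split=> //.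
- by rewrite tE.
- by move=> j lj; rewrite !tE; [apply: h3 | nat_lia | nat_lia].
- by move=> j lj; rewrite tE; [apply: h4 | nat_lia].
- by rewrite tE.
- by move=> j lj; rewrite !tE; [apply: h3 | nat_lia | nat_lia].
- by move=> n1; rewrite tE; [apply: h4 | nat_lia].
- by move=> j lj; rewrite tE; [apply: h5 | nat_lia].
Qed.

End Contexts.

Theorem theorem5p7 (V : finType) (e : rel V) (X Y Z : {set V})
    (x : V) (p : seq V) :
  acyclic e ->
  ~ has_active_cycle e ->
  X != set0 -> Y != set0 ->
  [disjoint X & Y] -> [disjoint X & Z] -> [disjoint Y & Z] ->
  local_relationships e (Y :|: Z) ->
  (exists x' p', TRAILS e X Y Z x' p') ->
  minimal_trail e X Y Z x p ->
  let C := nconv e x p in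
  let c := cnode e x p in
  let t := tnode e x p in
  [/\ (* (i) *)
      1 <= C -> c C \in Z,
      (* (ii) *)
      forall i, 1 <= i <= C.-1 -> (c i \in Z) || (c i.+1 \in Z),
      (* (iii) *)
      forall i, 1 <= i <= C -> adj e (c i) (c i.+1)
    & (* (iv) *)
      forall i, 1 <= i <= C ->
        let n := nt e x p i in
        [/\ e (c i) (c i.+1),
            e (t i 1) (c i),
            forall j, 1 <= j <= n -> e (t i j) (t i j.+1)
          & forall j, 2 <= j <= n -> e (c i) (t i j)]
        \/
        [/\ e (c i.+1) (c i),
            e (t i 1) (c i),
            forall j, 1 <= j <= n.-1 -> e (t i j.+1) (t i j),
            (* for n = 0 there is no node t^i_n strictly between c_i and
               c_(i+1) *)
            1 <= n -> e (t i n) (c i.+1)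
          & forall j, 1 <= j <= n.-1 -> e (c i.+1) (t i j)]].
Proof.
move=> acy nac _ _ dXY _ _ lr _ mp C c t.
have shape i := minimal_trail_shape acy (i := i) nac lr dXY mp.
split=> [C1|i li|i li|i li].
- by have [|+ _ _] := shape C; [rewrite C1 leqnn | apply].
- by have [|_ + _] := shape i; first by rewrite -/C; lia.
- have [//|_ _] := shape i.
  by rewrite /adj /= => -[[-> _ _ _]|[-> _ _ _ _]]; rewrite ?orbT.
- by have [//|_ _] := shape i.
Qed.
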